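(* Let $V$ be a real vector space of dimension $n\ge2$, let $d$ be a positive integer, and let $r$ be an integer with $1\le r\le n$. (i) When $r=1$ and $d$ is odd, the set $\{A\in\mathsf{S}^d(V):\mu\mathrm{rank}_{\mathsf{S}}(A)=1\}$ of symmetric multilinear rank-one real tensors is path-connected. (ii) When $r=1$ and $d$ is even, the set $\{A\in\mathsf{S}^d(V):\mu\mathrm{rank}_{\mathsf{S}}(A)=1\}$ has two connected components. (iii) When $d=2$, the set $\{A\in\mathsf{S}^d(V):\mu\mathrm{rank}_{\mathsf{S}}(A)=r\}$ of symmetric multilinear rank-$r$ real tensors has $r+1$ connected components. (iv) When $r\ge2$ and $d\ge3$, the set $\{A\in\mathsf{S}^d(V):\mu\mathrm{rank}_{\mathsf{S}}(A)=r\}$ is path-connected.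
   Context: All topological statements use the Euclidean topology. $\mathsf{S}^d(V)\subseteq V^{\otimes d}$ is the space of symmetric $d$-tensors. The symmetric multilinear rank $\mu\mathrm{rank}_{\mathsf{S}}(A)$ of $A\in\mathsf{S}^d(V)$ is the least $r\in\{0,1,2,\dots\}$ such that $A\in\mathsf{S}^d(U)$ for some linear subspace $U\subseteq V$ with $\dim U=r$. *)

(* Defs.v *)
From HB Require Import structures.
From mathcomp Require Import all_boot all_order all_algebra perm.
From mathcomp Require Import all_classical all_reals all_analysis.

Set Implicit Arguments.
Unset Strict Implicit.
Unset Printing Implicit Defensive.

Import Order.TTheory GRing.Theory Num.Theory.
Import numFieldNormedType.Exports.
Local Open Scope classical_set_scope.
Local Open Scope ring_scope.

Section Tensors.
Context {R : realType} (V : vectType R) (d : nat).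

Local Notation n := (\dim (fullv : {vspace V})).

(* V^{(x)d}, realized through coordinates: a tensor is the family of its n^d
   coordinates in the basis e_{J 0} (x) ... (x) e_{J (d-1)}, where e is the
   basis vbasis fullv of V.  The index set is finite, so the topology of
   pointwise convergence is the Euclidean topology. *)
Definition tensor := {ptws {ffun 'I_d -> 'I_n} -> R}.

HB.instance Definition _ := Uniform.on tensor.

(* v_0 (x) ... (x) v_(d-1) *)
Definition tprod (v : 'I_d -> V) : tensor :=
  fun J => \prod_(i < d) coord (vbasis fullv) (J i) (v i).

(* The subspace U^{(x)d} of V^{(x)d}: the linear span of the decomposable
   tensors with all factors in U. *)
Definition tensor_power (U : {vspace V}) : set tensor :=
  [set A | exists (m : nat) (c : 'I_m -> R) (u : 'I_m -> 'I_d -> V),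
     (forall k i, u k i \in U) /\
     A = (fun J => \sum_(k < m) c k * tprod (u k) J)].

Definition permute_tensor (s : 'S_d) (A : tensor) : tensor :=
  fun J => A [ffun i => J (s i)].

(* S^d(U) *)
Definition symmetric_power (U : {vspace V}) : set tensor :=
  [set A | tensor_power U A /\ forall s : 'S_d, permute_tensor s A = A].

(* mu rank_S(A) = r *)
Definition has_sym_mrank (A : tensor) (r : nat) : Prop :=
  (exists U : {vspace V}, \dim U = r /\ symmetric_power U A) /\
  (forall U : {vspace V}, symmetric_power U A -> (r <= \dim U)%N).

Definition sym_mrank_set (r : nat) : set tensor :=
  [set A | symmetric_power fullv A /\ has_sym_mrank A r].

(* tprod is multilinear and sends the tuples of basis vectors to the standard
   basis of the coordinate space, so (tensor, tprod) is a d-th tensor power of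
   V, and permute_tensor is the action of S_d on it by permuting factors. *)
Lemma tprod_basis (K : {ffun 'I_d -> 'I_n}) :
  tprod (fun i => (vbasis fullv)`_(K i)) = (fun J => (J == K)%:R).
Proof.
apply/funext => J; rewrite /tprod.
under eq_bigr => i _ do rewrite (coord_free _ _ (basis_free (vbasisP fullv))).
have [->|/eqP JK] := eqVneq J K; first by rewrite big1// => i _; rewrite eqxx.
have [i JKi] : exists i, J i != K i.
  apply: contra_notP JK => H; apply/ffunP => i; apply/eqP.
  by apply: contra_notT H => ?; exists i.
by rewrite (bigD1 i)//= eq_sym (negPf JKi) mul0r.
Qed.

Lemma tprod_linear (v : 'I_d -> V) (i : 'I_d) (a : R) (x y : V) J :
  let upd z := fun j => if j == i then z else v j in
  tprod (upd (a *: x + y)) J = a * tprod (upd x) J + tprod (upd y) J.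
Proof.
rewrite /tprod /= (bigD1 i)//= [in X in _ = a * X + _](bigD1 i)//=.
rewrite [X in _ = _ + X](bigD1 i)//= eqxx linearP/= mulrDl mulrA.
have E z : \prod_(j < d | j != i)
    coord (vbasis fullv) (J j) (if j == i then z else v j) =
  \prod_(j < d | j != i) coord (vbasis fullv) (J j) (v j).
  by apply: eq_bigr => j /negPf ->.
by rewrite !E.
Qed.

Lemma permute_tprod (s : 'S_d) (v : 'I_d -> V) :
  permute_tensor s (tprod v) = tprod (fun i => v ((s^-1)%g i)).
Proof.
apply/funext => J; rewrite /permute_tensor /tprod.
rewrite [RHS](reindex_inj (@perm_inj _ s))/=.
by apply: eq_bigr => i _; rewrite ffunE permK.
Qed.

Lemma tensor_power_fullv : tensor_power fullv = setT.
Proof.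
apply/seteqP; split => // A _.
exists #|{ffun 'I_d -> 'I_n}|, (fun k => A (enum_val k : {ffun 'I_d -> 'I_n})),
  (fun k i => (vbasis fullv)`_((enum_val k : {ffun 'I_d -> 'I_n}) i)).
split=> [k i|]; first exact: memvf.
apply/funext => J; under eq_bigr => k _ do rewrite tprod_basis.
rewrite (bigD1 (enum_rank J))//= enum_rankK eqxx mulr1 big1 ?addr0// => k kJ.
suff /negPf -> : J != enum_val k by rewrite mulr0.
by apply: contra kJ => /eqP ->; rewrite enum_valK.
Qed.

End Tensors.

Definition path_connected {R : realType} {T : topologicalType} (A : set T) :=
  forall x y, A x -> A y ->
    exists f : R -> T, [/\ {within `[0, 1], continuous f},
      f 0 = x, f 1 = y & forall t, 0 <= t <= 1 -> A (f t)].

Definition connected_components {T : topologicalType} (A : set T) :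
  set (set T) := [set connected_component A x | x in A].

(* Main.v *)
Require Import Defs.
From mathcomp Require Import all_boot all_order all_algebra perm.
From mathcomp Require Import all_classical all_reals all_analysis.
From mathcomp Require Import zify ring lra.

(** A symmetric tensor has symmetric multilinear rank [r] iff its flattening,
    an [n^(d-1)] by [n] matrix, has rank [r]: projecting slot after slot onto
    the row space of the flattening does not change the tensor.  So the set to
    study is a rank stratum of symmetric tensors, and its model points are the
    sums [\sum_i e_i x_i^{(x)d}] with [x] a frame (linearly independent) and
    all [e_i] nonzero.

    Two frames are joined by replacing vectors one at a time along segments, up
    to changing the sign of a vector.  A sign change is invisible when [d] is
    even; when [r >= 2] and all [e_i = 1], it follows from the invariance under
    swaps, since [(x, y)] moves to [(y, -x)] by elementary operations; and when
    [r = 1] it is possible because [n >= 2].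

    For [r = 1], and for [d = 2] by diagonalization, every tensor is a model
    point.  If [d] is even then the number of positive [e_i] is a locally
    constant invariant with [r + 1] values: by a dimension count, it can only
    increase near a given tensor, and so can the number of negative ones.

    For [r >= 2] and [d >= 3], adding [t l^{(x)d}] to a tensor [A] preserves its
    rank for all [t] as soon as [l] is in the row space of the flattening [F] of
    [A] while [l^{(x)(d-1)}] is not in its column space.  Such [l] exist near
    any vector of the row space because the powers [l^{(x)(d-1)}] span more than
    [r] dimensions.  Shrinking [A] and then adding powers of vectors close to a
    basis [x] of the row space of [F] leads to a convex neighborhood of
    [\sum_i x_i^{(x)d}] in which the rank is [r]. *)

Set Implicit Arguments.
Unset Strict Implicit.
Unset Printing Implicit Defensive.

Import Order.TTheory GRing.Theory Num.Theory.
Import numFieldNormedType.Exports.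
Import passmx.
Local Open Scope classical_set_scope.
Local Open Scope ring_scope.

(** * Flattenings of tensors *)

Section Flattening.
Context {R : realType} {n p : nat}.
Local Notation I := {ffun 'I_p.+1 -> 'I_n}.
Implicit Types (A B : I -> R) (J : I).

Definition upd (i : 'I_p.+1) (k : 'I_n) J : I :=
  [ffun j => if j == i then k else J j].

Definition symt A := forall s : 'S_p.+1, (fun J => A [ffun i => J (s i)]) = A.

(* Rows are indexed by full multi-indices, whose slot 0 is ignored. *)
Definition flat A : 'M[R]_(#|{: I}|, n) :=
  \matrix_(a, k) A (upd ord0 k (enum_val a)).

Definition sum_pow r (e : 'rV[R]_r) (X : 'M[R]_(r, n)) : I -> R :=
  fun J => \sum_i e 0 i * \prod_k X i (J k).

(** Column [i] holds the [p]-th tensor power of row [i] of [X], read in the slots other than 0. *)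
Definition slot_prod r (X : 'M[R]_(r, n)) : 'M[R]_(#|{: I}|, r) :=
  \matrix_(a, i) \prod_(k | k != ord0) X i ((enum_val a : I) k).

Lemma upd_id i k J : upd i k J i = k.
Proof. by rewrite ffunE eqxx. Qed.

Lemma upd_self i J : upd i (J i) J = J.
Proof. by apply/ffunP => j; rewrite ffunE; case: eqP => // ->. Qed.

Lemma flatE A J k : flat A (enum_rank J) k = A (upd ord0 k J).
Proof. by rewrite mxE enum_rankK. Qed.

Lemma flat_lin a b A B : flat (fun J => a * A J + b * B J) = a *: flat A + b *: flat B.
Proof. by apply/matrixP => i j; rewrite !mxE. Qed.

Lemma flat_sum_pow r (e : 'rV[R]_r) (X : 'M[R]_(r, n)) :
  flat (sum_pow e X) = slot_prod X *m diag_mx e *m X.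
Proof.
apply/matrixP => a k; rewrite !mxE; apply: eq_bigr => i _.
rewrite mul_mx_diag !mxE (bigD1 ord0)//= upd_id mulrCA mulrC; congr (_ * _).
rewrite mulrC; congr (_ * _).
by apply: eq_bigr => j /negPf j0; rewrite ffunE j0.
Qed.

Lemma flat_sum_pow_sub r (e : 'rV[R]_r) (X : 'M[R]_(r, n)) :
  (flat (sum_pow e X) <= X)%MS.
Proof. by rewrite flat_sum_pow submxMl. Qed.

Lemma symt_lin a b A B : symt A -> symt B -> symt (fun J => a * A J + b * B J).
Proof.
move=> sA sB s; apply/funext => J.
by have /(congr1 (@^~ J)) /= -> := sA s; have /(congr1 (@^~ J)) /= -> := sB s.
Qed.

Lemma symt_sum_pow r (e : 'rV[R]_r) (X : 'M[R]_(r, n)) : symt (sum_pow e X).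
Proof.
move=> s; apply/funext => J; apply: eq_bigr => i _; congr (_ * _).
rewrite [RHS](reindex_inj (@perm_inj _ s))/=.
by apply: eq_bigr => k _; rewrite ffunE.
Qed.

(* Contraction of the slots [i != 0] against the columns of [psi i]; the
   indicator of [k0] selects one of the redundant values of slot 0. *)
Definition contraction r (k0 : 'I_n) (psi : 'I_r -> 'I_p.+1 -> 'cV[R]_n) :
    'M[R]_(r, #|{: I}|) :=
  \matrix_(j, a) (((enum_val a : I) ord0 == k0)%:R *
     \prod_(i | i != ord0) psi j i ((enum_val a : I) i) 0).

(** The sum over multi-indices factors slot by slot; the indicator of [k0] makes slot 0 contribute 1
    instead of [n]. *)
Lemma contraction_slot_prod r s k0 psi (X : 'M[R]_(s, n)) (j : 'I_r) i :
  (contraction k0 psi *m slot_prod X) j i =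
  \prod_(k | k != ord0) (row i X *m psi j k) 0 0.
Proof.
pose G (k : 'I_p.+1) (m : 'I_n) : R :=
  if k == ord0 then (m == k0)%:R else X i m * psi j k m 0.
transitivity (\sum_(J : I) \prod_k G k (J k)).
  rewrite mxE (reindex _ (onW_bij _ (@enum_rank_bij I))) /=.
  apply: eq_bigr => J _; rewrite !mxE enum_rankK [RHS](bigD1 ord0)//= {1}/G eqxx.
  rewrite -mulrA; congr (_ * _); rewrite -big_split /=; apply: eq_bigr => k k0'.
  by rewrite /G (negPf k0') mulrC.
rewrite -bigA_distr_bigA (bigD1 ord0)//= [X in X * _](_ : _ = 1) ?mul1r.
  apply: eq_bigr => k /negPf kk; rewrite mxE; apply: eq_bigr => m _.
  by rewrite /G kk !mxE.
by rewrite (bigD1 k0)//= /G !eqxx big1 ?addr0// => m /negPf ->.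
Qed.

End Flattening.

(** * Compressing the flattening to a small square matrix *)

Section Pairing.
Context {R : realType} {n p r : nat}.
Local Notation I := {ffun 'I_p.+1 -> 'I_n}.
Implicit Types (A B : I -> R) (phi : 'M[R]_(n, r)).

(** Rows contract slots 1 to [p] against a column of [phi], columns contract slot 0. The result is
    linear in [A], bounds the rank of the flattening from below, and carries the signs of the
    coefficients. *)
Definition pairing (k0 : 'I_n) phi A : 'M[R]_r :=
  contraction (p := p) k0 (fun j _ => col j phi) *m flat A *m phi.

Lemma prod_slot_const (F : R) : \prod_(k < p.+1 | k != ord0) F = F ^+ p.
Proof.
rewrite prodr_const; congr (_ ^+ _).
transitivity #|predC1 (ord0 : 'I_p.+1)|; last by rewrite cardC1 card_ord.
exact: eq_card.
Qed.

Lemma pairing_rank k0 phi A : (\rank (pairing k0 phi A) <= \rank (flat A))%N.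
Proof. by rewrite (leq_trans (mxrankM_maxl _ _))// mxrankM_maxr. Qed.

Lemma pairing_lin k0 phi a b A B :
  pairing k0 phi (fun J => a * A J + b * B J) =
  a *: pairing k0 phi A + b *: pairing k0 phi B.
Proof. by rewrite /pairing flat_lin mulmxDr mulmxDl -!scalemxAr -!scalemxAl. Qed.

Lemma pairing_sum_pow k0 phi s (e : 'rV[R]_s) (X : 'M[R]_(s, n)) i j :
  pairing k0 phi (sum_pow e X) j i =
  \sum_k (X *m phi) k j ^+ p * e 0 k * (X *m phi) k i.
Proof.
rewrite /pairing flat_sum_pow !mulmxA -mulmxA mxE; apply: eq_bigr => k _.
rewrite mul_mx_diag mxE contraction_slot_prod; congr (_ * _ * _).
rewrite -prod_slot_const; apply: eq_bigr => l _.
by rewrite !mxE; apply: eq_bigr => m _; rewrite !mxE.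
Qed.

(** Off-diagonal entries carry the factor [0 ^+ p], which vanishes for [p > 0]; if [p = 0], then
    [r = 1] and there are none. *)
Lemma pairing_frame k0 phi (e : 'rV[R]_r) (X : 'M[R]_(r, n)) :
  X *m phi = 1%:M -> (r = 1 \/ 0 < p)%N ->
  pairing k0 phi (sum_pow e X) = diag_mx e.
Proof.
move=> Xphi rp; apply/matrixP => i j; rewrite pairing_sum_pow Xphi !mxE.
rewrite (bigD1 j)//= big1 ?addr0 => [|k kj].
  rewrite !mxE (eqxx j) mulr1; have [->|ij] := eqVneq i j.
    by rewrite ?(eqxx j) expr1n mul1r.
  case: rp => [r1|p0].
    by case/eqP: ij; apply/val_inj; move: (ltn_ord i) (ltn_ord j) => /=; lia.
  by rewrite expr0n eqn0Ngt p0 mul0r.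
by rewrite [X in _ * X]mxE (negPf kj) mulr0.
Qed.

End Pairing.

(** * Symmetric multilinear rank as the rank of the flattening *)

Section Characterization.
Context {R : realType}.

(** By symmetry any slot can be moved to slot 0, so one flattening controls all slots. *)
Lemma symt_upd n p (A : {ffun 'I_p.+1 -> 'I_n} -> R) i k J : symt A ->
  A (upd i k J) = A (upd ord0 k [ffun j => J (tperm ord0 i j)]).
Proof.
move=> /(_ (tperm ord0 i)) /(congr1 (@^~ (upd i k J))) /= <-; congr A.
apply/ffunP => j; rewrite !ffunE.
by rewrite (canF_eq (tpermK _ _)) tpermR.
Qed.

(* Projecting one slot after the other onto the row space of the flattening
   does not change the tensor. *)
Lemma symt_decomp n p (A : {ffun 'I_p.+1 -> 'I_n} -> R) : symt A ->
  exists m (c : 'I_m -> R) (u : 'I_m -> 'I_p.+1 -> 'rV[R]_n),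
    (forall k i, (u k i <= flat A)%MS) /\
    A = fun J => \sum_(k < m) c k * \prod_i u k i 0 (J i).
Proof.
(* [P] maps into the row space of [flat A] and is the identity on it. *)
move=> sA; pose P := pinvmx (flat A) *m flat A.
have FP : flat A *m P = flat A by rewrite mulmxA mulmxKpV.
have AP i J : A J = \sum_k A (upd i k J) * P k (J i).
  rewrite -{1}(upd_self i J) (symt_upd _ _ _ sA).
  set J' := [ffun _ => _]; rewrite -flatE -{1}FP mxE; apply: eq_bigr => k _.
  by rewrite flatE -(symt_upd _ _ _ sA).
(* After [t] rounds the first [t] factors of each term lie in the row space; the start is the
   expansion in standard basis tensors. *)
suff H (t : nat) : exists m (c : 'I_m -> R) (u : 'I_m -> 'I_p.+1 -> 'rV[R]_n),
    (forall k (i : 'I_p.+1), (i < t)%N -> (u k i <= flat A)%MS) /\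
    A = fun J => \sum_(k < m) c k * \prod_i u k i 0 (J i).
  have [m [c [u [uA AE]]]] := H p.+1; exists m, c, u; split => // k i.
  exact: uA (ltn_ord i).
elim: t => [|t [m [c [u [uA AE]]]]].
  pose T := {ffun 'I_p.+1 -> 'I_n}.
  exists #|{: T}|, (fun k => A (enum_val k)),
    (fun k i => delta_mx 0 ((enum_val k : T) i)); split => //.
  apply/funext => J; rewrite (bigD1 (enum_rank J))//= enum_rankK.
  rewrite big1 => [|i _]; last by rewrite mxE !eqxx.
  rewrite mulr1 big1 ?addr0// => k kJ.
  have [i JKi] : exists i, J i != (enum_val k : T) i.
    apply: contra_notP (elimN eqP kJ) => H.
    apply/(canRL enum_valK)/ffunP => i; apply/eqP.
    by apply: contra_notT H; rewrite eq_sym => ?; exists i.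
  by rewrite (bigD1 i)//= mxE eqxx (negPf JKi) mul0r mulr0.
have [tp|pt] := ltnP t p.+1; last first.
  exists m, c, u; split => // k i _; apply: uA.
  exact: leq_trans (ltn_ord i) pt.
pose i0 := Ordinal tp.
exists m, c, (fun k i => if i == i0 then u k i *m P else u k i); split.
  move=> k i; case: (eqVneq i i0) => [_ _|ii0 it].
    by rewrite mulmxA submxMl.
  apply: uA; rewrite ltn_neqAle -ltnS it andbT.
  by apply: contra ii0 => /eqP ?; apply/eqP/val_inj.
apply/funext => J; rewrite (AP i0) AE.
under eq_bigr do rewrite mulr_suml.
rewrite exchange_big /=; apply: eq_bigr => k _.
rewrite [in RHS](bigD1 i0)//= eqxx mxE mulrA mulr_sumr mulr_suml.
apply: eq_bigr => l _; rewrite (bigD1 i0)//= upd_id.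
rewrite (eq_bigr (fun i => (if i == i0 then u k i *m P else u k i) 0 (J i))); last first.
  by move=> i /negPf ii0; rewrite ffunE ii0.
ring.
Qed.

Lemma flat_decomp_sub n p m s (c : 'I_m -> R) (u : 'I_m -> 'I_p.+1 -> 'rV[R]_n)
    (X : 'M[R]_(s, n)) :
  (forall k i, (u k i <= X)%MS) ->
  (flat (fun J => \sum_(k < m) c k * \prod_i u k i 0 (J i))%R <= X)%MS.
Proof.
move=> uX; apply/row_subP => a.
rewrite (_ : row a _ = \sum_k (c k * \prod_(i | i != ord0)
    u k i 0 ((enum_val a : {ffun 'I_p.+1 -> 'I_n}) i)) *: u k ord0).
  by apply: summx_sub => k _; rewrite scalemx_sub.
apply/rowP => l; rewrite !mxE summxE; apply: eq_bigr => k _; rewrite mxE.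
rewrite (bigD1 ord0)//= upd_id -mulrA; congr (_ * _); rewrite mulrC; congr (_ * _).
by apply: eq_bigr => i /negPf i0; rewrite ffunE i0.
Qed.

Context (V : vectType R) (p : nat).
Local Notation n := (\dim (fullv : {vspace V})).
Local Notation e := (vbasis (fullv : {vspace V})).

Lemma tensor_power_rank (U : {vspace V}) (A : tensor V p.+1) :
  tensor_power U A -> (\rank (flat A) <= \dim U)%N.
Proof.
move=> [m [c [u [uU ->]]]].
pose X := \matrix_(i < \dim U) rVof e (vbasis U)`_i.
apply: leq_trans (rank_leq_row X); apply: mxrankS.
rewrite (_ : flat _ = flat (fun J : {ffun 'I_p.+1 -> 'I_n} =>
    \sum_(k < m) c k * \prod_i rVof e (u k i) 0 (J i))).
  apply: flat_decomp_sub => k i.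
  rewrite (coord_vbasis (uU k i)) linear_sum; apply: summx_sub => j _.
  by rewrite linearZ scalemx_sub//= -(rowK (fun i => rVof e (vbasis U)`_i)) row_sub.
congr flat; apply/funext => J; apply: eq_bigr => k _; congr (_ * _).
by apply: eq_bigr => i _; rewrite coord_rVof.
Qed.

(** [U] is the row space of the flattening, carried back to [V] by the basis [e]. *)
Lemma symt_tensor_power (A : tensor V p.+1) : symt A ->
  exists2 U : {vspace V}, tensor_power U A & (\dim U <= \rank (flat A))%N.
Proof.
move=> /symt_decomp [m [c [u [uA AE]]]].
pose X := row_base (flat A); pose s := [seq vecof e (row i X) | i : 'I_(\rank (flat A))].
exists (span s); last by rewrite (leq_trans (dim_span _))// size_map -cardE card_ord.
exists m, c, (fun k i => vecof e (u k i)); split => [k i|].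
  have : (u k i <= X)%MS by rewrite eq_row_base.
  move=> /submxP[a ->]; rewrite mulmx_sum_row linear_sum; apply: memv_suml => j _.
  by rewrite linearZ memvZ// memv_span//; apply: map_f; rewrite mem_enum.
rewrite AE; apply/funext => J; apply: eq_bigr => k _; congr (_ * _).
by apply: eq_bigr => i _; rewrite coord_vecof ?vbasisP.
Qed.

Lemma sym_mrank_setE r :
  sym_mrank_set r = [set A : tensor V p.+1 | symt A /\ \rank (flat A) = r].
Proof.
apply/seteqP; split => A /=.
  move=> [[_ sA] [[U [<- [UA _]]] Umin]]; split => //; apply/eqP.
  rewrite eqn_leq tensor_power_rank//=.
  have [W WA Wr] := symt_tensor_power sA.
  by apply: leq_trans Wr; apply: Umin.
move=> [sA <-]; split; first by split => //; rewrite tensor_power_fullv.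
have [W WA Wr] := symt_tensor_power sA.
split; last by move=> U [UA _]; exact: tensor_power_rank.
by exists W; split => //; apply/eqP; rewrite eqn_leq Wr tensor_power_rank.
Qed.

End Characterization.

(** * Paths and connected components *)

Section Paths.
Context {R : realType} {I : Type}.
Implicit Types (S : set (I -> R)) (x y z : I -> R).

(** Continuity is asked coordinate by coordinate and on all of [R], so that paths are built without
    a topology on the function space. *)
Definition path_in S x y := exists f : R -> I -> R,
  [/\ forall i, continuous (fun t => f t i), f 0 = x, f 1 = y &
      forall t, 0 <= t <= 1 -> S (f t)].

Lemma path_in_refl S x : S x -> path_in S x x.
Proof.
by move=> Sx; exists (fun=> x); split => // i; apply: cst_continuous.
Qed.

Lemma path_in_sym S x y : path_in S x y -> path_in S y x.
Proof.
move=> [f [fc <- <- fS]]; exists (fun t => f (1 - t)); split.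
- move=> i t; apply: (@continuous_comp _ _ _ (fun t : R => 1 - t) (fun t => f t i)).
    by apply: continuousB; [exact: cst_continuous|exact: cvg_id].
  exact: fc.
- by rewrite subr0.
- by rewrite subrr.
- by move=> t /andP[t0 t1]; apply: fS; rewrite subr_ge0 t1 gerBl.
Qed.

(* Clamping the parameters replaces the usual pasting of the two halves. *)
Lemma path_in_trans S x y z : path_in S x y -> path_in S y z -> path_in S x z.
Proof.
move=> [f [fc f0 f1 fS]] [g [gc g0 g1 gS]].
(* Up to time 1/2 the second term is constantly [y] and cancels; afterwards the first one does. *)
exists (fun t i => f (Num.min (2 * t) 1) i + g (Num.max (2 * t - 1) 0) i - y i).
have c2 : continuous (fun t : R => 2 * t).
  exact: mulrl_continuous.
have c21 : continuous (fun t : R => 2 * t - 1).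
  by move=> t; apply: continuousB; [exact: c2|exact: cst_continuous].
split.
- move=> i t /=; apply: cvgB; last exact: cvg_cst.
  apply: cvgD.
    apply: (@continuous_comp _ _ _ (fun t : R => Num.min (2 * t) 1) (fun t => f t i)).
      by apply: continuous_min; [exact: c2|exact: cst_continuous].
    exact: fc.
  apply: (@continuous_comp _ _ _ (fun t : R => Num.max (2 * t - 1) 0) (fun t => g t i)).
    by apply: continuous_max; [exact: c21|exact: cst_continuous].
  exact: gc.
- apply/funext => i; rewrite mulr0 min_l ?ler01// max_r ?subr_le0 ?ler01//.
  by rewrite f0 g0 addrK.
- apply/funext => i; rewrite mulr1 min_r ?ler1n// max_l; last by lra.
  have -> : (2 - 1 : R) = 1 by lra.
  by rewrite f1 g1 addrC addKr.
- move=> t /andP[t0 t1]; have [t2|t2] := leP (2 * t) 1.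
    rewrite max_r; last by lra.
    rewrite (_ : (fun i => _) = f (2 * t)); first by apply: fS; lra.
    by apply/funext => i; rewrite g0 addrK.
  rewrite max_l; last by lra.
  rewrite (_ : (fun i => _) = g (2 * t - 1)); first by apply: gS; lra.
  by apply/funext => i; rewrite f1 addrC addKr.
Qed.

Lemma path_in_poly S (P : I -> {poly R}) :
  (forall t, 0 <= t <= 1 -> S (fun i => (P i).[t])) ->
  path_in S (fun i => (P i).[0]) (fun i => (P i).[1]).
Proof.
move=> SP; exists (fun t i => (P i).[t]); split => // i.
exact: continuous_horner.
Qed.

Lemma path_in_segment S x y :
  (forall t, 0 <= t <= 1 -> S (fun i => (1 - t) * x i + t * y i)) ->
  path_in S x y.
Proof.
move=> xyS.
pose Q i := (x i)%:P + (y i - x i) *: 'X.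
have -> : path_in S x y = path_in S (fun i => (Q i).[0]) (fun i => (Q i).[1]).
  congr path_in; apply/funext => i; rewrite /Q hornerD hornerC hornerZ hornerX; ring.
apply: path_in_poly => t t01.
rewrite (_ : (fun i => _) = (fun i => (1 - t) * x i + t * y i)); first exact: xyS.
by apply/funext => i; rewrite /Q hornerD hornerC hornerZ hornerX; ring.
Qed.

End Paths.

(** * Counting components with a locally constant index *)

Section Components.
Context {T : topologicalType}.
Implicit Types S C : set T.

(** Within [C], both [P i] and the union of the other [P j] are relatively open, so connectedness
    leaves only [P i]. *)
Lemma connected_locally_constant (P : nat -> set T) C i x :
  (forall y, C y -> exists j, P j y) ->
  (forall j y, P j y -> \forall z \near y, forall k, P k z -> k = j) ->
  connected C -> C x -> P i x -> C `<=` P i.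
Proof.
move=> CP Ploc Cc Cx Pix.
(* [P j] need not be open in the whole space; [O j] is open and meets [C] in the same points. *)
pose O j := [set y | exists2 z, P j z & exists2 U, open_nbhs z U &
  (U y /\ forall w, U w -> forall k, P k w -> k = j)].
have Oo j : open (O j).
  rewrite openE => y [z Pz [U [Uo Uz] [Uy UP]]].
  apply: (@filterS _ (nbhs y) _ U); last exact: open_nbhs_nbhs.
  by move=> w Uw; exists z => //; exists U.
have PO j y : P j y -> O j y.
  move=> Py; have := Ploc _ _ Py; rewrite /prop_near1 nbhsE => -[U [Uo Uy] UP].
  by exists y => //; exists U => //; split => // w Uw k; exact: UP.
have OP j y : C y -> O j y -> P j y.
  move=> /CP[k Pky] [z _ [U _ [Uy UP]]].
  by rewrite -(UP _ Uy _ Pky).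
suff -> : C = C `&` P i by apply: subIsetr.
apply/esym/Cc.
- by exists x.
- exists (O i) => //; apply/seteqP; split => y [Cy]; first by move/PO.
  by move/(OP _ _ Cy).
- exists (~` (\bigcup_(j in [set j | j != i]) O j)).
    by apply: open_closedC; apply: bigcup_open.
  apply/seteqP; split => y [Cy Py]; split => //.
    move=> [j /= ji [z _ [U _ [Uy UP]]]].
    by move/eqP: ji; apply; rewrite (UP _ Uy _ Py).
  have [k Pk] := CP _ Cy; have [<-//|ki] := eqVneq k i.
  by exfalso; apply: Py; exists k => //; exact: PO.
Qed.

(** Each nonempty [P i] is an entire component, and disjointness makes different indices give
    different components. *)
Lemma card_connected_components S (P : nat -> set T) k :
  S = \bigcup_(i in `I_k) P i ->
  (forall i, (i < k)%N -> P i !=set0) ->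
  (forall i x y, P i x -> P i y -> connected_component S x y) ->
  (forall i x, P i x -> \forall y \near x, forall j, P j y -> j = i) ->
  (connected_components S #= `I_k)%card.
Proof.
move=> SP P0 Pconn Ploc.
have disj i j x : P i x -> P j x -> i = j.
  by move=> Pi Pj; exact: (nbhs_singleton (Ploc _ _ Pj)) Pi.
have compE i x : (i < k)%N -> P i x -> connected_component S x = P i.
  move=> ik Px; have Sx : S x by rewrite SP; exists i.
  apply/seteqP; split; last by move=> y; exact: Pconn Px.
  apply: (connected_locally_constant (x := x)) => //.
  - by move=> y /connected_component_sub; rewrite SP => -[j _ Pj]; exists j.
  - exact: component_connected.
  - exact: connected_component_refl.
have -> : connected_components S = P @` `I_k.
  apply/seteqP; split => C.
    by move=> [x Sx <-]; move: (Sx); rewrite {1}SP => -[i ik Pi]; exists i; rewrite // (compE i).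
  move=> [i ik <-]; have [x Pi] := P0 _ ik.
  by exists x; [rewrite SP; exists i|exact: compE].
rewrite card_eq_sym; apply/card_esym/inj_card_eq.
move=> i j; rewrite !inE => ik jk Pij; have [x Px] := P0 _ ik.
by apply: (disj _ _ x) => //; rewrite -Pij.
Qed.

End Components.

(** * Paths of frames *)

Section Frames.
Context {R : realType} {r n : nat}.
Implicit Types (X Y : 'M[R]_(r, n)) (w : 'rV[R]_n) (i j : 'I_r).

Definition setrow i w X := \matrix_k (if k == i then w else row k X).

(** Membership of [w] in the span of the rows of [X] other than row [i]. *)
Definition dep i X w := exists2 b : 'rV_r, b 0 i = 0 & b *m X = w.

Lemma row_setrow i w X k : row k (setrow i w X) = if k == i then w else row k X.
Proof. by rewrite rowK. Qed.

Lemma row_row_perm (s : 'S_r) X k : row k (row_perm s X) = row (s k) X.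
Proof. by apply/rowP => l; rewrite !mxE. Qed.

Lemma mul_setrow i w X (a : 'rV_r) :
  a *m setrow i w X = a *m X + a 0 i *: (w - row i X).
Proof.
rewrite !mulmx_sum_row (bigD1 i)//= [in RHS](bigD1 i)//= row_setrow eqxx.
rewrite scalerBr [RHS]addrC addrA subrK; congr (_ + _).
by apply: eq_bigr => k /negPf ki; rewrite row_setrow ki.
Qed.

Lemma dep_lin i X a b v w : dep i X v -> dep i X w -> dep i X (a *: v + b *: w).
Proof.
move=> [c ci <-] [d di <-]; exists (a *: c + b *: d).
  by rewrite !mxE ci di !mulr0 addr0.
by rewrite mulmxDl -!scalemxAl.
Qed.

Lemma depZ i X a w : a != 0 -> dep i X (a *: w) -> dep i X w.
Proof.
move=> a0 [c ci cw]; exists (a^-1 *: c); first by rewrite mxE ci mulr0.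
by rewrite -scalemxAl cw scalerA mulVf// scale1r.
Qed.

Lemma free_dep i X (a : 'rV_r) : row_free X -> dep i X (a *m X) -> a 0 i = 0.
Proof. by move=> /row_free_inj Xf [b bi /Xf <-]. Qed.

Lemma setrow_free i w X : row_free X -> ~ dep i X w -> row_free (setrow i w X).
Proof.
move=> /row_free_inj Xf Xw; apply: inj_row_free => v; rewrite mul_setrow.
have [->|vi] := eqVneq (v 0 i) 0.
  by rewrite scale0r addr0 => v0; apply: Xf; rewrite v0 mul0mx.
move=> v0; exfalso; apply: Xw; apply: (depZ vi).
(* The linear relation solved for [v 0 i *: w]; the coefficient of row [i] cancels. *)
exists (v 0 i *: delta_mx 0 i - v); first by rewrite !mxE !eqxx mulr1 subrr.
move/eqP: v0; rewrite addr_eq0 => /eqP v0.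
by rewrite mulmxBl -scalemxAl -rowE v0 opprK scalerBr addrC subrK.
Qed.

Lemma setrow_segment i w X t :
  (1 - t) *: X + t *: setrow i w X = setrow i ((1 - t) *: row i X + t *: w) X.
Proof.
apply/row_matrixP => k; rewrite linearD !linearZ /= !row_setrow.
by case: eqP => [->|_] //; rewrite -scalerDl subrK scale1r.
Qed.

Definition elem i j (c : R) X := setrow i (row i X + c *: row j X) X.

Lemma elem_free i j c X : i != j -> row_free X -> row_free (elem i j c X).
Proof.
move=> ij Xf; apply: setrow_free => //; rewrite !rowE scalemxAl -mulmxDl.
by move/(free_dep Xf)/eqP; rewrite !mxE !eqxx (negPf ij) mulr0 addr0 oner_eq0.
Qed.

Definition rotate i j X := setrow i (row j X) (setrow j (- row i X) X).

(** The quarter turn of two rows is a product of three shears, each reachable along a segment of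
    frames. *)
Lemma rotateE i j X : i != j ->
  rotate i j X = elem i j 1 (elem j i (-1) (elem i j 1 X)).
Proof.
move=> ij; have ji : (j == i) = false by rewrite eq_sym (negPf ij).
apply/row_matrixP => k; rewrite /rotate /elem !row_setrow !eqxx (negPf ij) !ji.
rewrite !scale1r !scaleN1r; case: eqP => _; first by rewrite addrC subrK.
by case: eqP => // _; rewrite addrC opprD subrK.
Qed.

Lemma rotate_free i j X : i != j -> row_free X -> row_free (rotate i j X).
Proof.
move=> ij Xf; have ji : j != i by rewrite eq_sym.
by rewrite rotateE//; do 3!apply: elem_free => //.
Qed.

(** [Rel] abstracts the existence of a path between the tensors of two frames, so that the moves
    serve for several choices of coefficients. *)
Context (Rel : 'M[R]_(r, n) -> 'M[R]_(r, n) -> Prop).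
Hypothesis Rel_trans : forall X Y Z, Rel X Y -> Rel Y Z -> Rel X Z.
Hypothesis Rel_segment : forall X Y,
  (forall t, 0 <= t <= 1 -> row_free ((1 - t) *: X + t *: Y)) -> Rel X Y.

Lemma Rel_refl X : row_free X -> Rel X X.
Proof. by move=> Xf; apply: Rel_segment => t _; rewrite -scalerDl subrK scale1r. Qed.

Lemma Rel_setrow i w X : row_free X ->
  (forall t, 0 <= t <= 1 -> ~ dep i X ((1 - t) *: row i X + t *: w)) ->
  Rel X (setrow i w X).
Proof.
move=> Xf Xw; apply: Rel_segment => t t01.
by rewrite setrow_segment setrow_free//; exact: Xw.
Qed.

Lemma Rel_elem i j c X : i != j -> row_free X -> Rel X (elem i j c X).
Proof.
move=> ij Xf; apply: Rel_segment => t t01; rewrite setrow_segment.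
rewrite scalerDr addrA -scalerDl subrK scale1r scalerA.
exact: elem_free.
Qed.

Lemma Rel_rotate i j X : i != j -> row_free X -> Rel X (rotate i j X).
Proof.
move=> ij Xf; have ji : j != i by rewrite eq_sym.
have Xf1 := elem_free 1 ij Xf; have Xf2 := elem_free (-1) ji Xf1.
rewrite rotateE//; apply: Rel_trans (Rel_elem _ ij Xf2).
exact: Rel_trans (Rel_elem _ ij Xf) (Rel_elem _ ji Xf1).
Qed.

(** A quarter turn takes [(x, y)] to [(y, -x)] and a swap then gives [(-x, y)]; a second row is
    available as [r > 1]. *)
Lemma flip_of_swap :
  (forall X i j, row_free X -> Rel X (row_perm (tperm i j) X)) -> (1 < r)%N ->
  forall X i, row_free X -> Rel X (setrow i (- row i X) X).
Proof.
move=> swap r1 X i Xf.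
have [j ij] : exists j, i != j.
  case: r r1 X i Xf => [|[|m]]// _ X i _; have [->|i0] := eqVneq i ord0.
    by exists ord_max.
  by exists ord0.
apply: Rel_trans (Rel_rotate ij Xf) _.
suff -> : setrow i (- row i X) X = row_perm (tperm i j) (rotate i j X).
  by apply: swap; exact: rotate_free.
apply/row_matrixP => k; rewrite row_row_perm !row_setrow.
case: tpermP => [->|->|/eqP /negPf -> /eqP /negPf ->] //.
  by rewrite !eqxx eq_sym (negPf ij).
by rewrite !eqxx eq_sym (negPf ij).
Qed.

Hypothesis Rel_flip : forall X i, row_free X -> Rel X (setrow i (- row i X) X).

(* If the segment from the old row to [w] meets the span of the other rows,
   then the segment to [- w] does not. *)
Lemma Rel_replace i w X : row_free X -> ~ dep i X w -> Rel X (setrow i w X).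
Proof.
move=> Xf Xw.
have Xi : ~ dep i X (row i X).
  by rewrite rowE => /(free_dep Xf)/eqP; rewrite mxE !eqxx oner_eq0.
have [H|] := pselect (forall t, 0 <= t <= 1 -> ~ dep i X ((1 - t) *: row i X + t *: w)).
  exact: Rel_setrow.
move=> /existsNP[t] /not_implyP[/andP[t0 t1] /contrapT dt].
have Nw : ~ dep i X (- w) by rewrite -scaleN1r => /(depZ _); rewrite oppr_eq0 oner_eq0 => /(_ isT).
apply: (@Rel_trans _ (setrow i (- w) X)).
  apply: Rel_setrow => // s /andP[s0 s1] ds.
  (* Eliminating row [i] between the two dependent points leaves [w] times [(1 - s) t + (1 - t) s].
     This is 0 only if [s = t] is 0 or 1, where the dependent point is row [i] or [w] itself. *)
  have := dep_lin (1 - s) (- (1 - t)) dt ds.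
  rewrite !scalerDr !scalerA addrACA -!scalerDl [c in c *: row i _](_ : _ = 0); last by ring.
  rewrite scale0r add0r scalerN -scaleNr -scalerDl.
  have [c0|c0] := eqVneq ((1 - s) * t + - (- (1 - t) * s)) 0; last by move/(depZ c0).
  have [t0'|t0'] := eqVneq t 0.
    by move: dt; rewrite t0' subr0 scale1r scale0r addr0.
  have s1' : s = 1 by nra.
  have t1' : t = 1 by nra.
  by move: dt; rewrite t1' subrr scale1r scale0r add0r.
have := Rel_flip i (setrow_free Xf Nw); rewrite row_setrow eqxx opprK.
rewrite (_ : setrow i w _ = setrow i w X)//.
by apply/row_matrixP => k; rewrite !row_setrow; case: eqP.
Qed.

(** The quarter turn gives [(y, -x)], and a flip of the second row gives [(y, x)]. *)
Lemma Rel_swap i j X : row_free X -> Rel X (row_perm (tperm i j) X).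
Proof.
move=> Xf; have [->|ij] := eqVneq i j.
  by rewrite tperm1 row_perm1; exact: Rel_refl.
apply: Rel_trans (Rel_rotate ij Xf) _.
have := Rel_flip j (rotate_free ij Xf).
rewrite (_ : setrow _ _ _ = row_perm (tperm i j) X)//.
apply/row_matrixP => k; rewrite row_row_perm !row_setrow !eqxx.
rewrite [j == i]eq_sym (negPf ij) opprK.
case: tpermP => [->|->|/eqP /negPf -> /eqP /negPf ->] //.
  by rewrite (negPf ij) eqxx.
by rewrite eqxx.
Qed.

(** Steinitz exchange from the last row down: row [k] of [Y] can replace some row [j <= k] of [X],
    since otherwise it would be a combination of later rows, which already agree with those of [Y].
    A swap then brings it to position [k]. *)
Lemma frames_connected X Y : row_free X -> row_free Y -> Rel X Y.
Proof.
move=> Xf Yf.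
suff H k : forall X, row_free X ->
    (forall i, (k <= i)%N -> row i X = row i Y) -> Rel X Y.
  by apply: (H r) => // i; rewrite leqNgt ltn_ord.
elim: k => [|k IH] {Xf}X Xf XY.
  have -> : X = Y by apply/row_matrixP => i; exact: XY.
  exact: Rel_refl.
have [rk|kr] := leqP r k.
  by apply: IH => // i ki; have := ltn_ord i; rewrite ltnNge (leq_trans rk ki).
pose k' := Ordinal kr.
have [j [jk jX]] : exists j : 'I_r, (j <= k)%N /\ ~ dep j X (row k' Y).
  apply: contrapT => H.
  have D j : (j <= k)%N -> dep j X (row k' Y).
    by move=> jk; apply: contrapT => Nd; apply: H; exists j.
  have [b _ bX] := D k' (leqnn _).
  have b0 j : (j <= k)%N -> b 0 j = 0.
    by move=> /D; rewrite -bX => /(free_dep Xf).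
  have : b *m Y = delta_mx 0 k' *m Y.
    rewrite -rowE -bX !mulmx_sum_row; apply: eq_bigr => i _.
    by have [/b0 ->|/XY ->] := leqP i k; rewrite ?scale0r.
  move/(row_free_inj Yf) => bE; have /eqP := b0 k' (leqnn _).
  by rewrite bE mxE !eqxx oner_eq0.
have X'f := setrow_free Xf jX.
apply: Rel_trans (Rel_replace Xf jX) _.
apply: Rel_trans (Rel_swap j k' X'f) _.
apply: IH.
  by rewrite row_permE /row_free eqmxMfull// row_full_unit unitmx_perm.
move=> i ki; rewrite row_row_perm row_setrow.
case: tpermP => [ij|->|/eqP ij /eqP ik].
- suff kj : k' = j by rewrite ij -kj eqxx.
  by apply/val_inj/eqP; rewrite eqn_leq /= jk -ij ki.
- by rewrite eqxx.
- rewrite (negPf ij); apply: XY; rewrite ltn_neqAle ki andbT.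
  by apply: contra ik => /eqP e; apply/eqP/val_inj.
Qed.

End Frames.

(** * Sums of powers *)

Section SumPowPaths.
Context {R : realType} {n p : nat} (k0 : 'I_n).
Local Notation I := {ffun 'I_p.+1 -> 'I_n}.
Implicit Types A B : I -> R.

Definition rank_set r : set (I -> R) := [set A | symt A /\ \rank (flat A) = r].

Lemma diag_mx_unit r (e : 'rV[R]_r) :
  (forall i, e 0 i != 0) -> diag_mx e \in unitmx.
Proof.
by move=> e0; rewrite unitmxE det_diag unitfE; apply/prodf_neq0 => i _.
Qed.

(** The rows of [X] bound the rank above; pairing with a right inverse of [X] gives the invertible
    [diag_mx e], which bounds it below. *)
Lemma sum_pow_rank_set r (e : 'rV[R]_r) X : (forall i, e 0 i != 0) ->
  (r = 1 \/ 0 < p)%N -> row_free X -> rank_set r (sum_pow e X).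
Proof.
move=> e0 rp Xf; split; first exact: symt_sum_pow.
apply/eqP; rewrite eqn_leq; apply/andP; split.
  by rewrite (leq_trans (mxrankS (flat_sum_pow_sub _ _)))// rank_leq_row.
have [phi Xphi] := row_freeP Xf.
rewrite -[X in (X <= _)%N](mxrank_unit (diag_mx_unit e0)) -(pairing_frame k0 e Xphi rp).
exact: pairing_rank.
Qed.

Lemma path_sum_pow_segment r (e : 'rV[R]_r) X Y : (forall i, e 0 i != 0) ->
  (r = 1 \/ 0 < p)%N ->
  (forall t, 0 <= t <= 1 -> row_free ((1 - t) *: X + t *: Y)) ->
  path_in (rank_set r) (sum_pow e X) (sum_pow e Y).
Proof.
move=> e0 rp XY.
pose P (J : I) : {poly R} := \sum_i (e 0 i)%:P * \prod_k
  ((X i (J k))%:P * (1 - 'X) + (Y i (J k))%:P * 'X).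
have PE t : (fun J => (P J).[t]) = sum_pow e ((1 - t) *: X + t *: Y).
  apply/funext => J; rewrite horner_sum; apply: eq_bigr => i _.
  rewrite hornerM hornerC horner_prod; congr (_ * _); apply: eq_bigr => k _.
  by rewrite !mxE hornerD !hornerM !hornerC hornerD hornerN hornerX hornerC; ring.
have := @path_in_poly R _ (rank_set r) P.
rewrite !PE subr0 subrr !scale1r !scale0r addr0 add0r; apply => t t01.
by rewrite PE; apply: sum_pow_rank_set => //; exact: XY.
Qed.

Lemma path_sum_pow_coef r (e f : 'rV[R]_r) X : (forall i, 0 < e 0 i * f 0 i) ->
  (r = 1 \/ 0 < p)%N -> row_free X ->
  path_in (rank_set r) (sum_pow e X) (sum_pow f X).
Proof.
move=> ef rp Xf; apply: path_in_segment => t /andP[t0 t1].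
rewrite (_ : (fun J => _) = sum_pow ((1 - t) *: e + t *: f) X).
  apply: sum_pow_rank_set => // i; rewrite !mxE; have := ef i.
  have [e0|e0|->] := ltgtP (e 0 i) 0; rewrite ?mul0r ?ltxx//.
    by rewrite nmulr_rgt0// => f0; rewrite lt_eqF//; nra.
  by rewrite pmulr_rgt0// => f0; rewrite gt_eqF//; nra.
apply/funext => J; rewrite /sum_pow !mulr_sumr -big_split /=.
by apply: eq_bigr => i _; rewrite !mxE; ring.
Qed.

Lemma sum_pow_setrow r (e : 'rV[R]_r) X i :
  sum_pow e (setrow i (- row i X) X) =
  sum_pow (\row_j (if j == i then (-1) ^+ p.+1 * e 0 j else e 0 j)) X :> (I -> R).
Proof.
apply/funext => J; apply: eq_bigr => j _; rewrite mxE.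
under eq_bigr do rewrite !mxE.
have [->|_] := eqVneq j i; last by congr (_ * _); apply: eq_bigr => k _; rewrite mxE.
transitivity (e 0 i * \prod_k (-1 * X i (J k))).
  by congr (_ * _); apply: eq_bigr => k _; rewrite !mxE mulN1r.
by rewrite big_split /= prodr_const card_ord mulrA [e 0 i * _]mulrC.
Qed.

(** With [p] odd the order [p.+1] is even, so flipping a row leaves the tensor unchanged. *)
Lemma path_even r (e : 'rV[R]_r) X Y : odd p -> (forall i, e 0 i != 0) ->
  row_free X -> row_free Y ->
  path_in (rank_set r) (sum_pow e X) (sum_pow e Y).
Proof.
move=> op e0; have rp : (r = 1 \/ 0 < p)%N by right; case: p op.
apply: (frames_connected (Rel := fun X Y => path_in (rank_set r) (sum_pow e X) (sum_pow e Y))).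
- by move=> ? ? ?; exact: path_in_trans.
- by move=> ? ?; exact: path_sum_pow_segment.
move=> {}X i Xf; rewrite sum_pow_setrow -signr_odd /= op.
rewrite (_ : \row_j _ = e); first exact/path_in_refl/sum_pow_rank_set.
by apply/rowP => j; rewrite mxE mul1r; case: eqP.
Qed.

(** Equal coefficients make the tensor invariant under swaps of rows, and swaps provide the
    flips. *)
Lemma path_const r (X Y : 'M[R]_(r, n)) : (1 < r)%N -> (0 < p)%N -> row_free X -> row_free Y ->
  path_in (rank_set r) (sum_pow (const_mx 1 : 'rV[R]_r) X) (sum_pow (const_mx 1 : 'rV[R]_r) Y).
Proof.
move=> r1 p0; have rp : (r = 1 \/ 0 < p)%N by right.
have e0 i : (const_mx 1 : 'rV[R]_r) 0 i != 0 by rewrite mxE oner_eq0.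
pose Rel (X Y : 'M[R]_(r, n)) := path_in (rank_set r)
  (sum_pow (const_mx 1 : 'rV[R]_r) X) (sum_pow (const_mx 1 : 'rV[R]_r) Y).
have Rt X1 X2 X3 : Rel X1 X2 -> Rel X2 X3 -> Rel X1 X3 by exact: path_in_trans.
have Rs X1 X2 : (forall t, 0 <= t <= 1 -> row_free ((1 - t) *: X1 + t *: X2)) ->
  Rel X1 X2 by exact: path_sum_pow_segment.
apply: (frames_connected Rt Rs); apply: (flip_of_swap Rt Rs) => // {}X i j Xf.
rewrite /Rel [X in path_in _ _ X](_ : _ = sum_pow (const_mx 1 : 'rV[R]_r) X).
  exact/path_in_refl/sum_pow_rank_set.
apply/funext => J; rewrite /sum_pow [RHS](reindex_inj (@perm_inj _ (tperm i j)))/=.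
by apply: eq_bigr => k _; rewrite !mxE; congr (_ * _); apply: eq_bigr => l _; rewrite mxE.
Qed.

Lemma path_line (X Y : 'rV[R]_n) : (1 < n)%N -> row_free X -> row_free Y ->
  path_in (rank_set 1) (sum_pow (const_mx 1 : 'rV[R]_1) X) (sum_pow (const_mx 1 : 'rV[R]_1) Y).
Proof.
move=> n1; have rp : (1 = 1 \/ 0 < p)%N by left.
have e0 i : (const_mx 1 : 'rV[R]_1) 0 i != 0 by rewrite mxE oner_eq0.
have nzf (x : 'rV[R]_n) : x != 0 -> row_free x by rewrite /row_free rank_rV => ->.
apply: (frames_connected (Rel := fun X Y : 'rV[R]_n => path_in (rank_set 1)
  (sum_pow (const_mx 1 : 'rV[R]_1) X) (sum_pow (const_mx 1 : 'rV[R]_1) Y))).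
- by move=> ? ? ?; exact: path_in_trans.
- by move=> ? ?; exact: path_sum_pow_segment.
move=> {}X i Xf; have -> : setrow i (- row i X) X = - X.
  by apply/row_matrixP => k; rewrite row_setrow !ord1 eqxx linearN.
(* A vector off the line of [X] lets one go from [X] to [- X] through [w] while avoiding 0. *)
have [w Xw] : exists w : 'rV[R]_n, ~~ (w <= X)%MS.
  have : ~~ (1%:M <= X)%MS.
    apply: contraTN n1 => /mxrankS; rewrite mxrank1 -leqNgt => /leq_trans; apply.
    exact: rank_leq_row.
  by move/row_subPn => [j]; exists (row j 1%:M).
have comb a b : (a != 0) || (b != 0) -> row_free (a *: X + b *: w).
  move=> ab; apply: nzf; have [b0|b0] := eqVneq b 0.
    move: ab; rewrite b0 eqxx orbF scale0r addr0 => a0.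
    rewrite scaler_eq0 negb_or a0 /=.
    by apply: contraTneq Xf => ->; rewrite /row_free mxrank0.
  apply: contra Xw; rewrite addrC addr_eq0 => /eqP bw.
  by rewrite -(eqmx_scale _ b0) bw -scaleNr scalemx_sub.
have nz t : ((1 - t : R) != 0) || (t != 0).
  by have [->|] := eqVneq t 0; rewrite ?orbT// subr0 oner_eq0.
apply: (@path_in_trans _ _ _ _ (sum_pow (const_mx 1 : 'rV[R]_1) w)).
  by apply: path_sum_pow_segment => // t _; exact: comb.
apply: path_sum_pow_segment => // t _; rewrite scalerN -scaleNr addrC.
by apply: comb; rewrite oppr_eq0 orbC.
Qed.

Lemma exists_frame m (M : 'M[R]_(m, n)) r : \rank M = r ->
  exists2 X : 'M[R]_(r, n), row_free X & (X == M)%MS.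
Proof.
by move=> <-; exists (row_base M); [exact: row_base_free|apply/eqmxP/eq_row_base].
Qed.

(** All factors of a decomposition lie on one line, so their scalars collect into a single
    coefficient. *)
Lemma rank_one_sum_pow A : rank_set 1 A ->
  exists c, exists2 x : 'rV[R]_n, row_free x & c != 0 /\ A = sum_pow (const_mx c : 'rV[R]_1) x.
Proof.
move=> [sA rA]; have [x xf /andP[_ Ax]] := exists_frame rA.
have [m [c [u [uA AE]]]] := symt_decomp sA.
pose b k i := (u k i *m pinvmx x) 0 0.
have ub k i : u k i = b k i *: x.
  by rewrite -[LHS](mulmxKpV (submx_trans (uA k i) Ax)) [u k i *m _]mx11_scalar mul_scalar_mx.
pose C := \sum_k c k * \prod_i b k i.
have AC : A = sum_pow (const_mx C : 'rV[R]_1) x.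
  rewrite AE; apply/funext => J; rewrite /sum_pow big_ord1 mxE mulr_suml.
  apply: eq_bigr => k _; rewrite -mulrA -big_split /=; congr (_ * _).
  by apply: eq_bigr => i _; rewrite ub mxE.
exists C, x => //; split => //; apply: contra_eqN rA => /eqP C0.
rewrite AC C0 (_ : flat _ = 0) ?mxrank0//.
by apply/matrixP => i j; rewrite !mxE /sum_pow big_ord1 mxE mul0r.
Qed.

End SumPowPaths.

(** * Signature *)

Section Signature.
Context {R : realType}.

(* [v G v^T] is at least [(m - r * eta) |v|^2] as [|v_i v_j| <= (v_i^2 + v_j^2) / 2]. *)
Lemma near_diag_pos r (G : 'M[R]_r) (e v : 'rV[R]_r) (eta m : R) :
  (forall i j, `|G i j - diag_mx e i j| <= eta) -> r%:R * eta < m ->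
  (forall i, v 0 i != 0 -> m <= e 0 i) -> v != 0 ->
  0 < \sum_i \sum_j v 0 i * v 0 j * G i j.
Proof.
move=> Ge rm ve v0.
have S0 : 0 < \sum_i v 0 i ^+ 2.
  have [i vi] : exists i, v 0 i != 0 by apply/rV0Pn.
  rewrite (bigD1 i)//= ltr_pwDl ?sumr_ge0//; last by move=> k _; exact: sqr_ge0.
  by rewrite lt0r sqrf_eq0 vi sqr_ge0.
apply: (@lt_le_trans _ _ ((m - r%:R * eta) * \sum_i v 0 i ^+ 2)).
  by rewrite mulr_gt0// subr_gt0.
rewrite -subr_ge0.
have eta0 (i : 'I_r) : 0 <= eta by exact: le_trans (normr_ge0 _) (Ge i i).
(* The lower bound is distributed over the entries: [m] on the diagonal, [r * eta] split evenly
   between rows and columns. Each entry is then nonnegative by itself. *)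
have expand (q : 'I_r -> R) (H : 'I_r -> 'I_r -> R) :
    \sum_i \sum_j H i j - (m - r%:R * eta) * \sum_i q i =
    \sum_i \sum_j (H i j + (- m) * ((i == j)%:R * q i) +
      (eta / 2 * q i + eta / 2 * q j)).
  have Sl : \sum_(i < r) \sum_(j < r) q i = r%:R * \sum_i q i.
    by rewrite mulr_sumr; apply: eq_bigr => i _; rewrite sumr_const card_ord mulr_natl.
  have Sr : \sum_(i < r) \sum_(j < r) q j = r%:R * \sum_i q i by rewrite exchange_big.
  have Sd : \sum_(i < r) \sum_(j < r) (i == j)%:R * q i = \sum_i q i.
    apply: eq_bigr => i _; rewrite (bigD1 i)//= eqxx mul1r big1 ?addr0// => j.
    by rewrite eq_sym => /negPf ->; rewrite mul0r.
  under [RHS]eq_bigr do rewrite !big_split /= -!mulr_sumr.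
  by rewrite !big_split /= -!mulr_sumr Sl Sr Sd; field.
rewrite expand.
apply: sumr_ge0 => i _; apply: sumr_ge0 => j _.
have e0 := eta0 i; move: (Ge i j); rewrite ler_norml mxE.
have [<-|ij] := eqVneq i j; rewrite ?mulr1n ?mulr0n ?mul1r ?mul0r => /andP[G1 G2].
  have [->|vi] := eqVneq (v 0 i) 0; first by rewrite !mul0r expr0n /= !mulr0 !addr0.
  have me := ve _ vi; have v2 : 0 <= v 0 i ^+ 2 by exact: sqr_ge0.
  rewrite [X in 0 <= X](_ : _ = v 0 i ^+ 2 * (G i i - m + eta)); last by field.
  by rewrite mulr_ge0//; clear -me G1; lra.
rewrite subr0 in G1 G2.
(* Off the diagonal, polarization writes the term through these two squares with weights
   [eta + G i j] and [eta - G i j]. *)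
have h1 : 0 <= (v 0 i + v 0 j) ^+ 2 by exact: sqr_ge0.
have h2 : 0 <= (v 0 i - v 0 j) ^+ 2 by exact: sqr_ge0.
rewrite [X in 0 <= X](_ : _ = ((eta + G i j) * (v 0 i + v 0 j) ^+ 2 +
   (eta - G i j) * (v 0 i - v 0 j) ^+ 2) / 4); last by field.
by rewrite divr_ge0// addr_ge0// mulr_ge0//; clear -G1 G2; lra.
Qed.

(** There are [#|P|] unknowns for [#|Q|] equations; [E] extends a solution by zero outside [P]. *)
Lemma supported_kernel r (Y : 'M[R]_r) (P Q : {set 'I_r}) : (#|Q| < #|P|)%N ->
  exists2 v : 'rV[R]_r, v != 0 & (forall i, v 0 i != 0 -> i \in P) /\
    (forall k, k \in Q -> \sum_i Y k i * v 0 i = 0).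
Proof.
move=> QP.
pose B := \matrix_(a < #|P|, b < #|Q|) Y (enum_val b) (enum_val a).
pose E : 'M[R]_(#|P|, r) := \matrix_(a, i) (i == enum_val a)%:R.
have : kermx B != 0.
  by rewrite -mxrank_eq0 mxrank_ker subn_eq0 -ltnNge (leq_ltn_trans (rank_leq_col _)).
move=> /rowV0Pn[w /sub_kermxP wB w0].
have wE a : (w *m E) 0 (enum_val a) = w 0 a.
  rewrite mxE (bigD1 a)//= mxE eqxx mulr1 big1 ?addr0// => b ba.
  by rewrite mxE (inj_eq enum_val_inj) eq_sym (negPf ba) mulr0.
exists (w *m E).
  by apply: contra_neq w0 => wE0; apply/rowP => a; rewrite -wE wE0 !mxE.
split => [i|k kQ].
  apply: contraNT => iP; rewrite mxE big1// => a _.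
  rewrite mxE; case: eqP => [ia|_]; last by rewrite mulr0.
  by case/negP: iP; rewrite ia enum_valP.
have /rowP/(_ (enum_rank_in kQ k)) := wB; rewrite !mxE => wB0.
rewrite -[RHS]wB0.
under eq_bigr do rewrite mxE mulr_sumr.
rewrite exchange_big /=; apply: eq_bigr => a _; rewrite mxE enum_rankK_in//.
rewrite (bigD1 (enum_val a))//= mxE eqxx mulr1 mulrC big1 ?addr0// => i ia.
by rewrite mxE (negPf ia) !mulr0.
Qed.

Definition npos r (e : 'rV[R]_r) := #|[set i | 0 < e 0 i]%SET|.

Lemma npos_opp r (e : 'rV[R]_r) : (forall i, e 0 i != 0) ->
  (npos e + npos (- e) = r)%N.
Proof.
move=> e0; rewrite /npos -[RHS](card_ord r) -(cardsC [set i | 0 < e 0 i]%SET).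
congr (_ + _)%N; apply: eq_card => i.
by rewrite !inE mxE oppr_gt0 -leNgt le_eqVlt (negPf (e0 i)).
Qed.

Context {n p : nat} (k0 : 'I_n).
Local Notation I := {ffun 'I_p.+1 -> 'I_n}.

Lemma pairing_sum_pow_form r s phi (e : 'rV[R]_s) (X : 'M[R]_(s, n)) (v : 'rV[R]_r) :
  \sum_i \sum_j v 0 i * v 0 j * pairing (p := p) k0 phi (sum_pow e X) i j =
  \sum_k e 0 k * ((\sum_i (X *m phi) k i ^+ p * v 0 i) * (\sum_i (X *m phi) k i * v 0 i)).
Proof.
under eq_bigr do under eq_bigr do rewrite pairing_sum_pow mulr_sumr.
under eq_bigr do rewrite exchange_big /=.
rewrite exchange_big /=; apply: eq_bigr => k _.
rewrite mulr_suml mulr_sumr; apply: eq_bigr => i _.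
by rewrite !mulr_sumr; apply: eq_bigr => j _; ring.
Qed.

(* The form attached to [sum_pow f Y] is positive on vectors supported where
   [e] is positive; a nonzero such vector annihilated by all rows with positive
   coefficient in [f] would exist if [npos f < npos e]. *)
Lemma npos_le r (e f : 'rV[R]_r) (X Y : 'M[R]_(r, n)) phi eta m :
  odd p -> (r = 1 \/ p = 1)%N -> X *m phi = 1%:M ->
  (forall i, m <= `|e 0 i|) -> r%:R * eta < m ->
  (forall i j, `|pairing (p := p) k0 phi (sum_pow f Y) i j - diag_mx e i j| <= eta) ->
  (npos e <= npos f)%N.
Proof.
move=> op rp Xphi me rm close; rewrite leqNgt; apply/negP.
move=> /(supported_kernel (Y *m phi))[v v0 [vP vQ]].
suff : \sum_i \sum_j v 0 i * v 0 j * pairing (p := p) k0 phi (sum_pow f Y) i j <= 0.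
  apply/negP; rewrite -ltNge; apply: (near_diag_pos close rm) => // i /vP.
  by rewrite inE => ei; rewrite (le_trans (me i))// gtr0_norm.
rewrite pairing_sum_pow_form; apply: sumr_le0 => k _.
(* Positive coefficients contribute 0 by the choice of [v]; the others multiply a nonnegative
   product. *)
have [fk|fk] := ltP 0 (f 0 k); first by rewrite vQ ?inE// !mulr0.
rewrite mulr_le0_ge0//; case: rp => [r1|->]; last first.
  by under eq_bigr do rewrite expr1; rewrite -expr2 sqr_ge0.
(* With a single column the product is a power of exponent [p.+1], which is even, times a square. *)
have line s (Z : 'M[R]_s) (w : 'rV[R]_s) (l : 'I_s) : s = 1%N ->
    0 <= (\sum_i Z l i ^+ p * w 0 i) * (\sum_i Z l i * w 0 i).
  move=> s1; subst s; rewrite !big_ord1 mulrACA -exprSr mulr_ge0//.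
    by rewrite exprn_even_ge0//= op.
  by rewrite -expr2 sqr_ge0.
exact: line.
Qed.

Definition signature_class r j : set (I -> R) :=
  [set A | exists e : 'rV[R]_r, exists2 X, row_free X &
     [/\ forall i, e 0 i != 0, npos e = j & A = sum_pow e X]].

(** Applying [npos_le] to the coefficients and to their opposites bounds the number of positive
    signs from both sides, since the two counts add up to [r]. *)
Lemma signature_class_near r i (A : I -> R) : odd p -> (r = 1 \/ p = 1)%N ->
  signature_class r i A -> exists phi : 'M[R]_(n, r), exists2 eta : R, 0 < eta &
    forall B j, signature_class r j B ->
    (forall k l, `|pairing (p := p) k0 phi B k l - pairing k0 phi A k l| <= eta) ->
    j = i.
Proof.
move=> op rp [e [X Xf [e0 <- ->]]]; have [phi Xphi] := row_freeP Xf.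
have rp' : (r = 1 \/ 0 < p)%N by case: rp => [->|->]; [left|right].
have [m m0 me] : exists2 m : R, 0 < m & forall i, m <= `|e 0 i|.
  have : \forall m \near (0:R)^'+, forall i, m <= `|e 0 i|.
    by apply: filter_forall => k; apply: nbhs_right_le; rewrite normr_gt0.
  move=> H; have [m [m0 mH]] := filter_ex (filterI (nbhs_right_gt 0) H).
  by exists m.
exists phi, (m / r.+1%:R); first by rewrite divr_gt0.
move=> B j [f [Y Yf [f0 <- ->]]]; rewrite (pairing_frame k0 e Xphi rp') => close.
have rm : r%:R * (m / r.+1%:R) < m.
  by rewrite mulrCA gtr_pMr// ltr_pdivrMr// mul1r ltr_nat.
apply/eqP; rewrite eqn_leq (npos_le op rp Xphi me rm close) andbT.
have me' i0 : m <= `|(- e) 0 i0| by rewrite mxE normrN.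
suff : (npos (- e) <= npos (- f))%N.
  by have := npos_opp e0; have := npos_opp f0; lia.
apply: (npos_le (f := - f) (Y := Y) op rp Xphi me' rm) => k l.
rewrite (_ : sum_pow (- f) Y = fun J => 0 * sum_pow f Y J + (-1) * sum_pow f Y J).
  rewrite pairing_lin scale0r add0r scaleN1r linearN /= !mxE -opprD normrN.
  by have := close k l; rewrite !mxE.
apply/funext => J; rewrite mul0r add0r mulr_sumr; apply: eq_bigr => q _.
by rewrite mxE !mulNr mul1r.
Qed.

End Signature.

(** * Diagonalization in order two *)

Section NormalForms.
Context {R : realType} {n : nat}.

(** By polarization, a symmetric form vanishing on the diagonal vanishes identically. *)
Lemma sym_form_neq0 (G : 'M[R]_n) : G^T = G -> G != 0 ->
  exists v : 'rV[R]_n, (v *m G *m v^T) 0 0 != 0.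
Proof.
move=> GT; apply: contra_neqP => H.
pose q (u v : 'rV[R]_n) := (u *m G *m v^T) 0 0.
have q0 v : q v v = 0 by apply: contra_notP H => /eqP ?; exists v.
have qC u v : q u v = q v u.
  have E : u *m G *m v^T = (v *m G *m u^T)^T by rewrite !trmx_mul trmxK GT mulmxA.
  by rewrite /q E [LHS]mxE.
have q00 u v : q u v = 0.
  have qD w : q (u + v) w = q u w + q v w by rewrite /q !mulmxDl mxE.
  have := q0 (u + v); rewrite qD [q u _]qC [q v _]qC !qD !q0 [q v u]qC add0r addr0 => /eqP.
  by rewrite -mulr2n mulrn_eq0 /= => /eqP.
apply/matrixP => i j; have := q00 (delta_mx 0 i) (delta_mx 0 j).
by rewrite /q -rowE trmx_delta -colE !mxE.
Qed.

(** Lagrange reduction: subtracting the square of the linear form [v G], divided by [c], lowers the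
    rank. *)
Lemma sym_diag (G : 'M[R]_n) : G^T = G ->
  exists s, (s <= \rank G)%N /\ exists (e : 'rV[R]_s) (X : 'M[R]_(s, n)),
    forall i j, G i j = \sum_k e 0 k * (X k i * X k j).
Proof.
have [m] := ubnP (\rank G); elim: m G => // m IH G Gm GT.
have [->|G0] := eqVneq G 0.
  exists 0; split; first by [].
  by exists 0, 0 => i j; rewrite big_ord0 mxE.
have [v] := sym_form_neq0 GT G0; set c := (_ *m _) 0 0 => c0.
pose a := v *m G; pose G' := G - c^-1 *: (a^T *m a).
have avc : a *m v^T = c%:M by rewrite [LHS]mx11_scalar.
have G'T : G'^T = G' by rewrite linearB linearZ /= trmx_mul trmxK GT.
have G'v : G' *m v^T = 0.
  rewrite mulmxBl -scalemxAl -mulmxA avc mul_mx_scalar scalerA mulVf// scale1r.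
  by rewrite /a trmx_mul GT subrr.
(* The inclusion is strict because [v^T] is killed by [G'] but not by [G]. *)
have G'G : (G' < G)%MS.
  rewrite ltmxE; apply/andP; split.
    by rewrite addmx_sub// eqmx_opp scalemx_sub// mulmxA submxMl.
  apply: contra c0 => /submxP[D GD].
  by rewrite /c GD -!mulmxA G'v !mulmx0 mxE.
have rG' := rank_ltmx G'G.
have [s [sr [e [X XE]]]] := IH G' (leq_trans rG' Gm) G'T.
exists (s + 1)%N; split; first by rewrite addn1 (leq_ltn_trans sr).
exists (row_mx e (const_mx c^-1)), (col_mx X a) => i j.
have outer (M : 'M[R]_n) k (b : 'rV[R]_n) :
    (M + k *: (b^T *m b)) i j = M i j + k * (b 0 i * b 0 j).
  by rewrite !mxE big_ord1 !mxE.
rewrite -{1}(subrK (c^-1 *: (a^T *m a)) G) outer XE big_split_ord big_ord1 /=.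
rewrite row_mxEr !col_mxEd [const_mx _ _ _]mxE; congr (_ + _); apply: eq_bigr => k _.
by rewrite row_mxEl !col_mxEu.
Qed.

Lemma matrix_sum_pow r (A : {ffun 'I_2 -> 'I_n} -> R) : rank_set r A ->
  exists e : 'rV[R]_r, exists2 X, row_free X & (forall i, e 0 i != 0) /\ A = sum_pow e X.
Proof.
move=> [sA rA].
(* Slot 0 of a row index is ignored, so constant multi-indices select one copy of each row of the
   flattening. *)
pose G := \matrix_(i, j) A (upd ord0 j [ffun=> i]).
have GA : (G <= flat A)%MS.
  apply/row_subP => i; rewrite (_ : row i G = row (enum_rank [ffun=> i]) (flat A)).
    exact: row_sub.
  by apply/rowP => j; rewrite !mxE enum_rankK.
have GT : G^T = G.
  apply/matrixP => i j; rewrite !mxE -{1}(sA (tperm ord0 ord_max)); congr A.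
  apply/ffunP => k; rewrite !ffunE; case: tpermP => [->|->|] //=.
  by case: k => [] [|[|]]//= k /eqP + /eqP.
have [s [sr [e [X XE]]]] := sym_diag GT.
have AE : A = sum_pow e X.
  apply/funext => J; have -> : A J = G (J ord_max) (J ord0).
    rewrite mxE; congr A; apply/ffunP => k; rewrite !ffunE.
    case: eqP => [->//|/eqP k0]; congr (J _); apply/val_inj.
    by case: k k0 => [] [|[|]].
  rewrite XE; apply: eq_bigr => k _; rewrite big_ord_recl big_ord1 /= [X k _ * _]mulrC.
  by do !congr (_ * _); congr (X _ (J _)); apply/val_inj.
(* The rank forces exactly [r] terms, and then makes [X] free and [e] nowhere zero. *)
have srk : s = r.
  apply/eqP; rewrite eqn_leq -{1}rA (leq_trans sr (mxrankS GA))/=.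
  by rewrite -rA AE (leq_trans (mxrankS (flat_sum_pow_sub _ _)))// rank_leq_row.
subst s; exists e, X.
  rewrite /row_free eqn_leq rank_leq_row -{1}rA AE.
  by rewrite (mxrankS (flat_sum_pow_sub _ _)).
split => // i.
have : diag_mx e \in unitmx.
  rewrite -row_free_unit /row_free eqn_leq rank_leq_row -{1}rA AE flat_sum_pow.
  by rewrite (leq_trans (mxrankM_maxl _ _))// mxrankM_maxr.
by rewrite unitmxE det_diag unitfE => /prodf_neq0; apply.
Qed.

End NormalForms.

(** * Paths inside a signature class *)

Section ClassPaths.
Context {R : realType} {n p : nat} (k0 : 'I_n).
Local Notation I := {ffun 'I_p.+1 -> 'I_n}.

(** The sign patterns are boolean tuples with equally many [true], hence permutations of each
    other. *)
Lemma perm_same_signs r (e f : 'rV[R]_r) : npos e = npos f ->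
  exists s : 'S_r, forall i, (0 < e 0 (s i)) = (0 < f 0 i).
Proof.
move=> ef; pose t (g : 'rV[R]_r) := [tuple 0 < g 0 i | i < r].
have ct (g : 'rV[R]_r) : count id (t g) = npos g.
  rewrite /= count_map /npos cardsE cardE size_filter enumT; exact: eq_count.
have /tuple_permP[s sE] : perm_eq (t f) (t e).
  have cs (g : 'rV[R]_r) : (count id (t g) + count negb (t g) = r)%N.
    by rewrite (count_predC id) size_tuple.
  apply/seq.permP => a.
  have ca (u : seq bool) : count a u = (a true * count id u + a false * count negb u)%N.
    by elim: u => [|[] u /= ->] /=; rewrite ?muln0//; lia.
  by rewrite !ca; have := cs e; have := cs f; rewrite !ct ef; lia.
exists s => i; have : tnth (t f) i = tnth (t e) (s i).
  by rewrite (tnth_nth false) sE -tnth_nth tnth_mktuple.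
by rewrite !tnth_mktuple.
Qed.

Lemma sum_pow_perm r (s : 'S_r) (e : 'rV[R]_r) (X : 'M[R]_(r, n)) :
  sum_pow (col_perm s e) (row_perm s X) = sum_pow e X :> (I -> R).
Proof.
apply/funext => J; rewrite /sum_pow [RHS](reindex_inj (@perm_inj _ s))/=.
by apply: eq_bigr => k _; rewrite mxE; congr (_ * _); apply: eq_bigr => l _; rewrite mxE.
Qed.

Lemma signature_class_path r j (A B : I -> R) : odd p ->
  signature_class r j A -> signature_class r j B -> path_in (rank_set r) A B.
Proof.
move=> op [e [X Xf [e0 ej ->]]] [f [Y Yf [f0 fj ->]]].
have rp : (r = 1 \/ 0 < p)%N by right; case: p op.
have [s sE] := perm_same_signs (etrans ej (esym fj)).
(* Moving to the reordered frame first lets a reindexing by [s] turn it into [Y], with coefficients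
   of the same signs as [f]. *)
apply: path_in_trans (path_even k0 op e0 Xf (Y := row_perm s^-1 Y) _) _.
  by rewrite row_permE /row_free eqmxMfull// row_full_unit unitmx_perm.
rewrite -(sum_pow_perm s) -row_permM mulgV row_perm1.
apply: path_sum_pow_coef => // i; rewrite mxE; have := sE i.
have := f0 i; have := e0 (s i).
have [e1|e1|->] := ltgtP (e 0 (s i)) 0; rewrite ?eqxx//;
  have [f1|f1|->] := ltgtP (f 0 i) 0; rewrite ?eqxx//; nra.
Qed.

Lemma signature_class_neq0 r j : (r <= n)%N -> (j <= r)%N ->
  exists A : I -> R, signature_class r j A.
Proof.
move=> rn jr; pose e : 'rV[R]_r := \row_i (if (i < j)%N then 1 else -1).
exists (sum_pow e (pid_mx r)), e, (pid_mx r).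
  by rewrite /row_free rank_pid_mx.
split => //.
  by move=> i; rewrite mxE; case: ifP; rewrite ?oppr_eq0 oner_eq0.
rewrite /npos cardsE -sum1_card (eq_bigl (fun i : 'I_r => (i < j)%N)).
  by rewrite -(big_ord_widen r (fun=> 1%N) jr) sum1_card card_ord.
move=> i; change ((0 < e 0 i) = (i < j)%N); rewrite mxE.
by case: ifP; rewrite ?ltr01// oppr_gt0 ltr10.
Qed.

End ClassPaths.

(** * From coordinatewise paths to the topology of tensors *)

Section TensorTopology.
Context {R : realType} (V : vectType R) (d : nat).
Local Notation n := (\dim (fullv : {vspace V})).
Local Notation I := {ffun 'I_d -> 'I_n}.

Lemma tensor_eval_continuous (J : I) : continuous (fun A : tensor V d => A J).
Proof. exact: (@proj_continuous I (fun=> R) J). Qed.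

Lemma tensor_path_continuous (f : R -> I -> R) :
  (forall J, continuous (fun t => f t J)) ->
  continuous (f : R -> tensor V d).
Proof.
move=> fc t; apply/cvg_sup => J.
by apply: (@continuous_comp_initial _ R _ (fun A : I -> R => A J)); exact: fc.
Qed.

Lemma path_in_connected_component (S : set (tensor V d)) (x y : tensor V d) :
  path_in S x y -> connected_component S x y.
Proof.
move=> [f [fc f0 f1 fS]]; exists ((f : R -> tensor V d) @` `[0, 1]).
  split.
  - by exists 0 => //=; rewrite in_itv /= lexx ler01.
  - by move=> A [t /=]; rewrite in_itv /= => t01 <-; exact: fS.
  - apply: connected_continuous_connected; first exact: segment_connected.
    exact/continuous_subspaceT/tensor_path_continuous.
by exists 1 => //=; rewrite in_itv /= lexx ler01.
Qed.

Lemma path_in_path_connected (S : set (tensor V d)) :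
  (forall x y : tensor V d, S x -> S y -> path_in S x y) -> path_connected (R := R) S.
Proof.
move=> H x y Sx Sy; have [f [fc f0 f1 fS]] := H x y Sx Sy.
by exists f; split => //; exact/continuous_subspaceT/tensor_path_continuous.
Qed.

End TensorTopology.

(** * Counting the components in even order *)

Section CountComponents.
Context {R : realType} (V : vectType R) (p r : nat).
Local Notation n := (\dim (fullv : {vspace V})).
Local Notation I := {ffun 'I_p.+1 -> 'I_n}.
Context (k0 : 'I_n).

Lemma pairing_continuous (phi : 'M[R]_(n, r)) i j :
  continuous (fun A : tensor V p.+1 => pairing k0 phi A i j).
Proof.
have E (A : tensor V p.+1) : pairing k0 phi A i j =
    \sum_l \sum_a (contraction (p := p) k0 (fun j _ => col j phi) i a * phi l j) *
      A (upd ord0 l (enum_val a)).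
  rewrite mxE; apply: eq_bigr => l _; rewrite mxE mulr_suml.
  by apply: eq_bigr => a _; rewrite [flat _ _ _]mxE mulrAC.
rewrite (funext E).
apply: continuous_big => [|l _]; first exact: add_continuous.
apply: continuous_big => [|a _]; first exact: add_continuous.
set c := _ * _; set J := upd _ _ _.
move=> A; apply: (@continuous_comp _ _ _ (fun A : tensor V p.+1 => A J) (fun x : R => c * x)).
  exact: tensor_eval_continuous.
exact: mulrl_continuous.
Qed.

Lemma card_components_signature : (r <= n)%N -> odd p -> (r = 1 \/ p = 1)%N ->
  (connected_components (rank_set r : set (tensor V p.+1)) #= `I_r.+1)%card.
Proof.
move=> rn op rp; have rp' : (r = 1 \/ 0 < p)%N by right; case: p op.
apply: (@card_connected_components (tensor V p.+1) _ (signature_class r)).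
- apply/seteqP; split => A.
    move=> SA; have [e [X Xf [e0 ->]]] : exists e : 'rV[R]_r, exists2 X : 'M[R]_(r, n),
        row_free X & (forall i, e 0 i != 0) /\ A = sum_pow e X.
      move: A SA; case: rp => [->|->] A SA; last exact: matrix_sum_pow.
      have [c [x xf [c0 ->]]] := rank_one_sum_pow SA.
      by exists (const_mx c), x => //; split => // i; rewrite mxE.
    exists (npos e); last by exists e, X.
    by rewrite /= ltnS -[X in (_ <= X)%N](card_ord r) max_card.
  by move=> [j _ [e [X Xf [e0 _ ->]]]]; exact: sum_pow_rank_set.
- by move=> j; rewrite ltnS => jr; exact: signature_class_neq0.
- move=> j A B jA jB; apply: path_in_connected_component.
  exact: signature_class_path jA jB.
- move=> j A jA; have [phi [eta eta0 H]] := signature_class_near k0 op rp jA.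
  (* Finitely many continuous entries stay within [eta] on a common neighborhood. *)
  have : \forall B \near (A : tensor V p.+1), forall kl : 'I_r * 'I_r,
      `|pairing k0 phi A kl.1 kl.2 - pairing k0 phi B kl.1 kl.2| <= eta.
    apply: (@filter_forall _ _ _ (nbhs (A : tensor V p.+1)) (nbhs_filter _)) => kl.
    have /cvgrPdist_le := @pairing_continuous phi kl.1 kl.2 A; exact.
  apply: filterS => B BA i iB; apply: (H _ _ iB) => k l.
  by rewrite distrC; exact: (BA (k, l)).
Qed.

End CountComponents.

(** * Rank at least two and order at least three *)

Section GenericPath.
Context {R : realType} {n p : nat} (k0 : 'I_n).
Local Notation I := {ffun 'I_p.+1 -> 'I_n}.
Implicit Types A B : I -> R.

Definition power (l : 'rV[R]_n) : I -> R := sum_pow (const_mx 1 : 'rV[R]_1) l.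

Lemma diag_const1 r : diag_mx (const_mx 1 : 'rV[R]_r) = 1%:M.
Proof. by apply/matrixP => i j; rewrite !mxE. Qed.

Lemma flat_power (l : 'rV[R]_n) : flat (power l) = slot_prod l *m l.
Proof. by rewrite flat_sum_pow diag_const1 mulmx1. Qed.

(** The new flattening is [F + t q l]. Whatever it annihilates on the right is annihilated by [F],
    since otherwise [q] would lie in the column space of [F]. *)
Lemma add_power_rank A (l : 'rV[R]_n) t :
  (l <= flat A)%MS -> ~~ ((slot_prod (p := p) l)^T <= (flat A)^T)%MS ->
  (flat (fun J => (1 * A J + t * power l J)%R) == flat A)%MS.
Proof.
move=> lA qA; rewrite flat_lin scale1r flat_power.
set q := slot_prod l in qA *; set F := flat A in lA qA *.
apply/andP; split.
  by rewrite addmx_sub// scalemx_sub// (submx_trans (submxMl _ _)).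
set N := F + _; rewrite submxE; move: (mulmx_coker N); move: (cokermx N) => K.
rewrite /N mulmxDl -scalemxAl -mulmxA scalemxAr; set w := t *: _ => /eqP.
rewrite addr_eq0 => /eqP FK; rewrite FK oppr_eq0.
have [->|] := eqVneq w 0; first by rewrite mulmx0.
move/rV0Pn => [j wj]; case/negP: qA; apply/submxP.
exists (- ((w 0 j)^-1 *: col j K))^T.
rewrite -trmx_mul; congr (_^T).
rewrite mulmxN -scalemxAr colE mulmxA FK mulNmx scalerN opprK -mulmxA -colE.
have -> : col j w = (w 0 j)%:M by rewrite [LHS]mx11_scalar mxE.
by rewrite mul_mx_scalar scalerA mulVf// scale1r.
Qed.

(* The [r] products of the rows of [X] span a space of dimension [r] which does
   not contain the product of the sum of two rows. *)
Lemma exists_direction r A (X : 'M[R]_(r, n)) : (1 < r)%N -> (1 < p)%N ->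
  row_free X -> (\rank (flat A) <= r)%N ->
  exists2 u : 'rV[R]_n, (u <= X)%MS & ~~ ((slot_prod (p := p) u)^T <= (flat A)^T)%MS.
Proof.
move=> r1 p1 Xf rA; apply: contrapT => H.
have D (u : 'rV[R]_n) : (u <= X)%MS -> ((slot_prod (p := p) u)^T <= (flat A)^T)%MS.
  by move=> uX; apply: contrapT => /negP qu; apply: H; exists u.
have [phi Xphi] := row_freeP Xf.
have XphiE i j : (row i X *m col j phi) 0 0 = (i == j)%:R.
  have := congr1 (fun M : 'M[R]_r => M i j) Xphi; rewrite !mxE => <-.
  by apply: eq_bigr => k _; rewrite !mxE.
pose Q := slot_prod (p := p) X.
have QA : (Q^T <= (flat A)^T)%MS.
  apply/row_subP => i; have := D (row i X) (row_sub _ _); congr (_ <= _)%MS.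
  by apply/rowP => a; rewrite !mxE; apply: eq_bigr => k _; rewrite mxE.
have rQ : \rank Q^T = r.
  apply/eqP; rewrite eqn_leq rank_leq_row /= mxrank_tr.
  apply: leq_trans (mxrankM_maxr (contraction (p := p) k0 (fun j _ => col j phi)) Q).
  rewrite (_ : _ *m Q = 1%:M) ?mxrank1//; apply/matrixP => i j.
  rewrite contraction_slot_prod XphiE prod_slot_const mxE [j == i]eq_sym.
  by case: eqP => _; rewrite ?expr1n// expr0n; case: p p1.
(* Comparing ranks, the powers of the rows of [X] span the whole column space. *)
have AQ : ((flat A)^T <= Q^T)%MS.
  by have := mxrank_leqif_sup QA; rewrite rQ mxrank_tr => /geq_leqif <-.
pose i0 : 'I_r := Ordinal (ltnW r1); pose i1 : 'I_r := Ordinal r1.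
have i01 : i0 != i1 by rewrite -val_eqE.
pose u := row i0 X + row i1 X.
have := submx_trans (D u (addmx_sub (row_sub _ _) (row_sub _ _))) AQ.
move=> /submxP[a /(congr1 trmx)]; rewrite trmx_mul !trmxK => qu.
pose j1 : 'I_p.+1 := inord 1; pose j2 : 'I_p.+1 := inord 2.
have p0 := ltnW p1.
have j10 : j1 != ord0 by rewrite -val_eqE /= inordK.
have j20 : j2 != ord0 by rewrite -val_eqE /= inordK.
have j21 : j2 != j1 by rewrite -val_eqE /= !inordK.
(* Slot 1 is tested against the dual vector of row [i0], the others against that of row [i1]. This
   kills the power of every row of [X] but is 1 on the power of [u]; slot 2 exists as [p > 1]. *)
pose psi (_ : 'I_1) (k : 'I_p.+1) := col (if k == j1 then i0 else i1) phi.
have /(congr1 (fun M => (contraction k0 psi *m M) 0 0)) := qu.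
rewrite contraction_slot_prod mulmxA [RHS]mxE [RHS]big1; last first.
  move=> i _; rewrite contraction_slot_prod (bigD1 j1)//= (bigD1 j2) ?j20//=.
  rewrite /psi eqxx (negPf j21) !XphiE.
  have [->|_] := eqVneq i i0; last by rewrite !mul0r.
  by rewrite (negPf i01) mul0r mulr0 mul0r.
rewrite big1 => [/eqP|k _]; first by rewrite oner_eq0.
rewrite row_id mulmxDl mxE !XphiE; case: ifP => _.
  by rewrite eqxx eq_sym (negPf i01) addr0.
by rewrite eqxx (negPf i01) add0r.
Qed.

Lemma poly_nonroot (P : {poly R}) (e : R) : P != 0 -> 0 < e ->
  exists2 x, 0 < x < e & P.[x] != 0.
Proof.
move=> P0 e0; apply: contrapT => H.
(* These are [size P] distinct points strictly between 0 and [e], more than [P] can have as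
   roots. *)
pose f (i : nat) := e / i.+2%:R.
have fi i : 0 < f i < e.
  by rewrite divr_gt0//= ltr_pdivrMr// ltr_pMr// ltr1n.
have : (size [seq f i | i <- iota 0 (size P)] < size P)%N.
  apply: max_poly_roots => //.
    apply/allP => x /mapP[i _ ->]; apply: contrapT => nr.
    by apply: H; exists (f i) => //; exact/negP.
  rewrite map_inj_uniq ?iota_uniq// => i j /(mulfI (lt0r_neq0 e0))/invr_inj/eqP.
  by rewrite eqr_nat => /eqP[].
by rewrite size_map size_iota ltnn.
Qed.

(** A coordinate of the class modulo [W] is a polynomial in [t], nonzero at [t = 1], hence nonzero
    at points arbitrarily close to 0. *)
Lemma direction_near (x u : 'rV[R]_n) m (W : 'M[R]_(m, #|{: I}|)) (Q : R -> Prop) :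
  ~~ ((slot_prod u)^T <= W)%MS -> (\forall t \near (0 : R), Q t) ->
  exists2 t, Q t & ~~ ((slot_prod (p := p) ((1 - t) *: x + t *: u))^T <= W)%MS.
Proof.
rewrite submxE => /rV0Pn[j uj] /nbhs_ballP[e /= e0 eQ].
pose P : {poly R} := \sum_a (\prod_(k | k != ord0)
   ((x 0 ((enum_val a : I) k))%:P * (1 - 'X) + (u 0 ((enum_val a : I) k))%:P * 'X)) *
   (cokermx W a j)%:P.
have PE t : P.[t] = ((slot_prod (p := p) ((1 - t) *: x + t *: u))^T *m cokermx W) 0 j.
  rewrite horner_sum mxE; apply: eq_bigr => a _.
  rewrite hornerM hornerC horner_prod !mxE; congr (_ * _); apply: eq_bigr => k _.
  by rewrite !mxE hornerD !hornerM !hornerC hornerD hornerN hornerX hornerC; ring.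
have P0 : P != 0.
  apply: contra_neq uj => P0; have := PE 1.
  by rewrite P0 horner0 subrr scale0r add0r scale1r => <-.
have [t /andP[t0 te] Pt] := poly_nonroot P0 e0.
exists t; first by apply: eQ; rewrite /ball /= sub0r normrN gtr0_norm.
by rewrite submxE; apply/rV0Pn; exists j; rewrite -PE.
Qed.

Section Step.
Context {r : nat} (X : 'M[R]_(r, n)) (phi : 'M[R]_(n, r)).
Hypothesis (r1 : (1 < r)%N) (p1 : (1 < p)%N) (Xphi : X *m phi = 1%:M).

Let rp : (r = 1 \/ 0 < p)%N. Proof. by right; exact: ltnW. Qed.

Let Xf : row_free X. Proof. by apply/row_freeP; exists phi. Qed.

Lemma rank_set_eqmx A B : rank_set r A -> symt B -> (flat B == flat A)%MS ->
  rank_set r B.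
Proof. by move=> [_ rA] sB BA; split => //; rewrite (eqmxP BA). Qed.

Lemma shrink A eta : 0 < eta -> rank_set r A -> (flat A == X)%MS ->
  exists B, [/\ path_in (rank_set r) A B, rank_set r B, (flat B == X)%MS &
    forall i j, `|pairing (p := p) k0 phi B i j| <= eta].
Proof.
move=> eta0 SA AX.
have [c c0 cP] : exists2 c : R, 0 < c &
    forall i j, `|c * pairing (p := p) k0 phi A i j| <= eta.
  have H : \forall c \near (0 : R)^'+, forall ij : 'I_r * 'I_r,
      c <= eta / (1 + `|pairing (p := p) k0 phi A ij.1 ij.2|).
    apply: filter_forall => ij; apply: nbhs_right_le.
    by rewrite divr_gt0// ltr_pwDl.
  have [c [c0 cH]] := filter_ex (filterI (nbhs_right_gt (0 : R)) H).
  exists c => // i j; have := cH (i, j) => /=; set m := pairing _ _ _ _ _.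
  have m0 : 0 <= `|m| by [].
  rewrite ler_pdivlMr ?ltr_pwDl// normrM (gtr0_norm c0); apply: le_trans.
  by rewrite ler_pM2l// lerDr.
have scaleP b : 0 < b -> rank_set r (fun J => b * A J + 0 * A J) /\
    (flat (fun J => (b * A J + 0 * A J)%R) == flat A)%MS.
  move=> b0; have E : (flat (fun J => (b * A J + 0 * A J)%R) == flat A)%MS.
    rewrite flat_lin scale0r addr0; apply/eqmxP/eqmx_scale.
    by rewrite gt_eqF.
  split => //; apply: rank_set_eqmx E => //; apply: symt_lin; exact: SA.1.
have [SB BA] := scaleP c c0.
exists (fun J => c * A J + 0 * A J); split => //.
- apply: path_in_segment => t /andP[t0 t1].
  rewrite (_ : (fun J => _) = (fun J => ((1 - t) + t * c) * A J + 0 * A J)).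
    by apply: (scaleP _ _).1; rewrite ltNge; apply/negP => ?; nra.
  by apply/funext => J; ring.
- by apply/eqmxP/(eqmx_trans (eqmxP BA))/eqmxP.
- by move=> i j; rewrite pairing_lin scale0r addr0 mxE.
Qed.

(** The power of row [k] of [X] has as pairing the matrix unit at [(k, k)]; a nearby vector [l t]
    has almost the same pairing and can be added without changing the rank. *)
Lemma add_direction A eta k : 0 < eta -> rank_set r A -> (flat A == X)%MS ->
  exists B, [/\ path_in (rank_set r) A B, rank_set r B, (flat B == X)%MS &
    forall i j, `|pairing (p := p) k0 phi B i j - pairing (p := p) k0 phi A i j
      - ((i == k) && (j == k))%:R| <= eta].
Proof.
move=> eta0 SA AX.
have [u uX uA] := exists_direction r1 p1 Xf (eq_leq SA.2).
pose l t := (1 - t) *: row k X + t *: u.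
pose g (ij : 'I_r * 'I_r) (t : R) :=
  ((1 - t) * (k == ij.1)%:R + t * (u *m phi) 0 ij.1) ^+ p *
  ((1 - t) * (k == ij.2)%:R + t * (u *m phi) 0 ij.2).
have pg t i j : pairing (p := p) k0 phi (power (l t)) i j = g (i, j) t.
  have lphi m : (l t *m phi) 0 m = (1 - t) * (k == m)%:R + t * (u *m phi) 0 m.
    rewrite mulmxDl -!scalemxAl -row_mul Xphi [LHS]mxE; congr (_ + _).
      by rewrite !mxE.
    by rewrite mxE.
  by rewrite pairing_sum_pow big_ord1 [const_mx _ _ _]mxE mulr1 !lphi.
have gnear : \forall t \near (0 : R), forall ij, `|g ij 0 - g ij t| <= eta.
  apply: (@filter_forall _ _ _ (nbhs (0 : R)) (nbhs_filter _)) => ij.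
  pose P : {poly R} :=
    ((1 - 'X) * ((k == ij.1)%:R)%:P + 'X * ((u *m phi) 0 ij.1)%:P) ^+ p *
    ((1 - 'X) * ((k == ij.2)%:R)%:P + 'X * ((u *m phi) 0 ij.2)%:P).
  have gP t : P.[t] = g ij t.
    by rewrite /P /g hornerM horner_exp !hornerD !hornerM !hornerD !hornerN !hornerX !hornerC.
  have /cvgrPdist_le/(_ eta eta0) := @continuous_horner R P 0.
  by apply: filterS => t; rewrite !gP.
have [t gt lA] := direction_near (row k X) uA gnear.
have lX : (l t <= flat A)%MS.
  by rewrite (eqmxP AX) addmx_sub ?scalemx_sub ?row_sub.
have SE s : (flat (fun J => (1 * A J + s * power (l t) J)%R) == flat A)%MS.
  exact: add_power_rank.
have SS s : rank_set r (fun J => 1 * A J + s * power (l t) J).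
  apply: rank_set_eqmx (SE s) => //; apply: symt_lin; first exact: SA.1.
  exact: symt_sum_pow.
exists (fun J => 1 * A J + 1 * power (l t) J); split => //.
- apply: path_in_segment => s _.
  rewrite (_ : (fun J => _) = (fun J => 1 * A J + s * power (l t) J)) //.
  by apply/funext => J; ring.
- by apply/eqmxP/(eqmx_trans (eqmxP (SE 1)))/eqmxP.
- move=> i j; rewrite pairing_lin !scale1r [fun_of_matrix (_ + _) i j]mxE.
  rewrite [pairing _ _ A i j + _]addrC addrK pg.
  have g0 : g (i, j) 0 = ((i == k) && (j == k))%:R.
    rewrite /g /= subr0 !mul0r !addr0 !mul1r ![k == _]eq_sym.
    case: (i == k); rewrite ?expr1n ?mul1r// expr0n.
    by rewrite (gtn_eqF (ltnW p1)) mul0r.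
  by rewrite -g0 distrC.
Qed.

(** A matrix this close to the identity has a positive definite form, so it is invertible. *)
Lemma pairing_close_rank B eta : r%:R * eta < 1 ->
  (forall i j, `|pairing (p := p) k0 phi B i j - (i == j)%:R| <= eta) ->
  (r <= \rank (flat B))%N.
Proof.
move=> reta close; apply: leq_trans (pairing_rank k0 phi B).
set M := pairing _ _ _ in close *.
suff : row_free M by move=> /eqP ->.
apply: inj_row_free => v vM; apply: contrapT => /eqP v0.
have := @near_diag_pos R r M (const_mx 1) v eta 1 _ reta _ v0.
rewrite (_ : \sum_i _ = 0) ?ltxx; last first.
  rewrite exchange_big /= big1// => j _.
  transitivity (v 0 j * (v *m M) 0 j); last by rewrite vM mxE mulr0.
  by rewrite mxE mulr_sumr; apply: eq_bigr => i _; ring.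
move=> F; suff : false by []; apply: F => [i j|i _]; last by rewrite mxE.
by rewrite diag_const1 [1%:M _ _]mxE; exact: close.
Qed.

(** One shrinking and one addition per row of [X] bring the pairing close to the identity, the
    pairing of the target. Closeness persists along the final segment and bounds the rank below; the
    row space of [X] bounds it above. *)
Lemma path_to_sum_pow A : rank_set r A -> (flat A == X)%MS ->
  path_in (rank_set r) A (sum_pow (const_mx 1) X).
Proof.
move=> SA AX.
(* The shrinking and the [r] additions cost [r.+1] errors of at most [eta], in total [1 / r.+1], and
   [r] times this is below 1. *)
pose eta : R := (r.+1%:R * r.+1%:R)^-1.
have eta0 : 0 < eta by rewrite invr_gt0 mulr_gt0.
have H k : (k <= r)%N -> exists B, [/\ path_in (rank_set r) A B, rank_set r B,
    (flat B == X)%MS & forall i j, `|pairing (p := p) k0 phi B i j -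
      ((i == j) && (i < k)%N)%:R| <= k.+1%:R * eta].
  elim: k => [_|k IH kr].
    have [B [AB SB BX pB]] := shrink eta0 SA AX; exists B; split => // i j.
    by rewrite andbF subr0 mul1r.
  have [B [AB SB BX pB]] := IH (ltnW kr).
  have [C [BC SC CX pC]] := add_direction (Ordinal kr) eta0 SB BX.
  exists C; split => //; first exact: path_in_trans AB BC.
  move=> i j.
  have -> : (((i == j) && (i < k.+1)%N)%:R : R) = ((i == j) && (i < k)%N)%:R +
      ((i == Ordinal kr) && (j == Ordinal kr))%:R.
    rewrite -!val_eqE /= ltnS -natrD; congr (_%:R).
    by case: (ltngtP (i : nat) k) => ik; case: (eqVneq (i : nat) (j : nat)) => ij; lia.
  rewrite -[k.+2%:R]natr1 mulrDl mul1r.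
  set a := pairing _ _ _ _ _; have := pB i j; have := pC i j; rewrite -/a.
  set b := pairing _ _ _ _ _ => hb ha.
  apply: le_trans (lerD ha hb); apply: le_trans (ler_normD _ _).
  by rewrite le_eqVlt; apply/orP; left; apply/eqP; congr (`|_|); ring.
have [B [AB SB BX pB]] := H r (leqnn r).
apply: path_in_trans AB _; apply: path_in_segment => t /andP[t0 t1].
split; first by apply: symt_lin; [exact: SB.1|exact: symt_sum_pow].
apply/eqP; rewrite eqn_leq; apply/andP; split.
  apply: leq_trans (rank_leq_row X); apply: mxrankS.
  by rewrite flat_lin addmx_sub// scalemx_sub// ?(eqmxP BX)// flat_sum_pow_sub.
apply: (@pairing_close_rank _ (r.+1%:R * eta)).
  have r0 : (0 : R) < r.+1%:R by [].
  have -> : r.+1%:R * eta = r.+1%:R^-1 by rewrite /eta invfM mulVKf// gt_eqF.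
  by rewrite ltr_pdivrMr// mul1r ltr_nat.
move=> i j; rewrite pairing_lin (pairing_frame k0 (const_mx 1) Xphi rp) diag_const1.
rewrite [fun_of_matrix (_ + _) i j]mxE ![fun_of_matrix (_ *: _) i j]mxE [1%:M i j]mxE.
have := pB i j; rewrite ltn_ord andbT => h.
rewrite (_ : _ - _ = (1 - t) * (pairing k0 phi B i j - (i == j)%:R)); last by ring.
rewrite normrM ger0_norm ?subr_ge0// -[leRHS]mul1r ler_pM ?subr_ge0//.
by rewrite gerBl.
Qed.

End Step.

Lemma rank_set_path r A B : (1 < r)%N -> (1 < p)%N ->
  rank_set r A -> rank_set r B -> path_in (rank_set r) A B.
Proof.
move=> r1 p1 SA SB.
have toX (C : I -> R) : rank_set r C -> exists2 X : 'M[R]_(r, n), row_free X &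
    path_in (rank_set r) C (sum_pow (const_mx 1) X).
  move=> SC; have [X Xf /andP[XC CX]] := exists_frame SC.2.
  have [phi Xphi] := row_freeP Xf.
  by exists X => //; apply: (path_to_sum_pow r1 p1 Xphi) => //; rewrite CX XC.
have [X Xf AX] := toX A SA; have [Y Yf BY] := toX B SB.
apply: path_in_trans AX _; apply: path_in_trans (path_in_sym BY).
by apply: (path_const k0) => //; exact: ltnW.
Qed.

End GenericPath.

(** * Rank one in odd order, and assembly of the four cases *)

Lemma path_rank_one_odd (R : realType) n p (k0 : 'I_n)
    (A B : {ffun 'I_p.+1 -> 'I_n} -> R) : (1 < n)%N -> ~~ odd p ->
  rank_set 1 A -> rank_set 1 B -> path_in (rank_set 1) A B.
Proof.
move=> n1 ep SA SB; have rp : (1 = 1 \/ 0 < p)%N by left.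
have toX (C : {ffun 'I_p.+1 -> 'I_n} -> R) : rank_set 1 C ->
    exists2 x : 'rV[R]_n, row_free x &
      path_in (rank_set 1) C (sum_pow (const_mx 1 : 'rV[R]_1) x).
  move=> /rank_one_sum_pow[c [x xf [c0 ->]]].
  have [cneg|cpos|/eqP] := ltgtP c 0; last by rewrite (negPf c0).
    (* In odd order a negative coefficient is absorbed by changing the sign of the vector. *)
    have -> : sum_pow (const_mx c : 'rV[R]_1) x = sum_pow (const_mx (- c) : 'rV[R]_1) (- x)
        :> ({ffun 'I_p.+1 -> 'I_n} -> R).
      apply/funext => J; rewrite /sum_pow !big_ord1 !mxE.
      under [in RHS]eq_bigr do rewrite mxE -mulN1r.
      rewrite big_split /= prodr_const card_ord -signr_odd /= ep /= expr1.
      by rewrite mulN1r mulrNN.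
    exists (- x); first by rewrite /row_free eqmx_opp.
    by apply: (path_sum_pow_coef k0) => //; [move=> i; rewrite !mxE mulr1 oppr_gt0
      |rewrite /row_free eqmx_opp].
  exists x => //; apply: (path_sum_pow_coef k0) => // i.
  by rewrite !mxE mulr1.
have [x xf Ax] := toX A SA; have [y yf By] := toX B SB.
apply: path_in_trans Ax _; apply: path_in_trans (path_in_sym By).
exact: path_line.
Qed.

Theorem theorem9p2 (R : realType) (V : vectType R) (n d r : nat)
    (dimV : \dim (fullv : {vspace V}) = n) (n_ge2 : (2 <= n)%N)
    (d_gt0 : (0 < d)%N) (r_ge1 : (1 <= r)%N) (r_len : (r <= n)%N) :
  let S : set (tensor V d) := sym_mrank_set r in
  [/\ r = 1%N -> odd d -> path_connected (R := R) S,
      r = 1%N -> ~~ odd d -> (connected_components S #= `I_2)%card,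
      d = 2%N -> (connected_components S #= `I_(r.+1))%card &
      (2 <= r)%N -> (3 <= d)%N -> path_connected (R := R) S].
Proof.
case: d d_gt0 => // p _ S; subst n.
have k0 : 'I_(\dim (fullv : {vspace V})) := Ordinal (ltnW n_ge2).
rewrite {}/S sym_mrank_setE; split.
- move=> -> /= op; apply: path_in_path_connected => A B.
  exact: path_rank_one_odd.
- move=> r1; rewrite /= negbK => op.
  have -> : 2%N = r.+1 by rewrite r1.
  by apply: card_components_signature => //; left.
- move=> [p1]; apply: card_components_signature => //; last by right.
  by rewrite p1.
- move=> r2 p2; apply: path_in_path_connected => A B.
  exact: rank_set_path.
Qed.
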